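(* Let $d\ge1$ be an integer. For each $N\in\mathbb{N}$ let $\mathcal{A}=\mathcal{A}^{(N)}=\{A_1,\dots,A_N\}$ be an area-regular partition of $\mathbb{S}^d$, i.e. the $A_i$ are pairwise disjoint measurable sets with $\bigcup_{i=1}^NA_i=\mathbb{S}^d$ and $\sigma(A_i)=\frac1N$, satisfying $\operatorname{diam}(A_i)\le C_dN^{-1/d}$ for $i=1,\dots,N$ with a constant $C_d$ depending only on $d$ (not on $N$ or $i$). Then the associated jittered sampling point process $(\mathscr{X}_N^{\mathcal{A}})_{N}$ is hyperuniform in all three regimes, that is: (i) (large caps) for every fixed $\phi\in(0,\frac{\pi}{2})$, $V(\mathscr{X}_N^{\mathcal{A}},\phi)=o(N)$ as $N\to\infty$; (ii) (small caps) for every sequence $(\phi_N)_{N\in\mathbb{N}}$ of opening angles with $\lim_{N\to\infty}\phi_N=0$ and $\lim_{N\to\infty}N\sigma(C(\phi_N))=\infty$, $V(\mathscr{X}_N^{\mathcal{A}},\phi_N)=o\left(N\sigma(C(\phi_N))\right)$ as $N\to\infty$; (iii) (threshold order) $\limsup_{N\to\infty}V(\mathscr{X}_N^{\mathcal{A}},tN^{-\frac1d})=\mathcal{O}(t^{d-1})$ as $t\to\infty$.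
   Context: $\mathbb{S}^d\subset\mathbb{R}^{d+1}$ is the unit sphere and $\sigma$ its normalised surface area measure. For $\mathbf{x}\in\mathbb{S}^d$, $C(\mathbf{x},\phi)=\{\mathbf{y}\in\mathbb{S}^d : \langle\mathbf{x},\mathbf{y}\rangle>\cos\phi\}$ is the open spherical cap with center $\mathbf{x}$ and opening angle $\phi$; $\sigma(C(\phi))$ denotes $\sigma(C(\mathbf{x},\phi))$, which does not depend on $\mathbf{x}$. The jittered sampling process $\mathscr{X}_N^{\mathcal{A}}$ associated with the partition $\mathcal{A}=\{A_1,\dots,A_N\}$ consists of $N$ independent random points, one in each $A_i$, the point in $A_i$ being distributed according to the uniform probability measure $\sigma_i(\cdot)=N\sigma(\cdot\cap A_i)$. The number variance averages over the center of the cap with respect to $\sigma$; explicitly, $$V(\mathscr{X}_N^{\mathcal{A}},\phi)=\int_{\mathbb{S}^d}\int_{A_1}\cdots\int_{A_N}\left(\sum_{i=1}^N\mathbb{1}_{C(\mathbf{x},\phi)}(\mathbf{y}_i)-N\sigma(C(\phi))\right)^2\,d\sigma_1(\mathbf{y}_1)\cdots d\sigma_N(\mathbf{y}_N)\,d\sigma(\mathbf{x}).$$ *)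

(* Defs.v *)
From HB Require Import structures.
From mathcomp Require Import all_boot all_order all_algebra.
From mathcomp Require Import all_classical all_reals all_analysis.
From mathcomp Require Import measurable_realfun ring.

Set Implicit Arguments.
Unset Strict Implicit.
Unset Printing Implicit Defensive.

Import Order.TTheory GRing.Theory Num.Theory.
Import numFieldNormedType.Exports.

Local Open Scope classical_set_scope.
Local Open Scope ring_scope.

(* Euclidean space R^n is n.-tuple R, whose library
   sigma-algebra is the product of the Borel sigma-algebras, i.e. the Borel
   sigma-algebra of R^n; S^d is a subset of d.+1.-tuple R. *)

Section euclidean.
Context {R : realType} {n : nat}.
Implicit Types x y : n.-tuple R.

Definition dot x y : R := \sum_(i < n) tnth x i * tnth y i.

Definition edist x y : R :=
  Num.sqrt (\sum_(i < n) (tnth x i - tnth y i) ^+ 2).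

Definition scale (r : R) x : n.-tuple R := [tuple r * tnth x i | i < n].

Definition diam (A : set (n.-tuple R)) : \bar R :=
  ereal_sup [set (edist p.1 p.2)%:E | p in A `*` A].

Definition sphere : set (n.-tuple R) := [set x | dot x x = 1].

Definition cap x (phi : R) : set (n.-tuple R) :=
  [set y | sphere y /\ cos phi < dot x y].

(* The part of the cone over A in the closed unit ball, without its apex. *)
Definition cone (A : set (n.-tuple R)) : set (n.-tuple R) :=
  [set scale r y | r in `]0, 1] & y in A `&` sphere].

End euclidean.

Fixpoint lebesgue {R : realType} (n : nat) : set (n.-tuple R) -> \bar R :=
  if n is m.+1 then
    pushforward (@lebesgue_measure R \x @lebesgue R m)%E
      (fun p => [the m.+1.-tuple R of p.1 :: p.2])
  else dirac [tuple].
Arguments lebesgue {R} n _.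

Section with_sigma_finite.
Context {R : realType} d (T : measurableType d) (m : {measure set T -> \bar R}).

Definition with_sigma_finite of sigma_finite setT m : set T -> \bar R := m.

HB.instance Definition _ sfm := Measure.on (with_sigma_finite sfm).

HB.instance Definition _ sfm :=
  Measure_isSigmaFinite.Build _ _ _ (with_sigma_finite sfm) sfm.

End with_sigma_finite.

Section measure_structures.
Context {R : realType}.
Local Open Scope ereal_scope.

Lemma pushforward_measureP d1 d2 (T1 : measurableType d1)
    (T2 : measurableType d2) (m : {measure set T1 -> \bar R}) (f : T1 -> T2) :
  measurable_fun [set: T1] f ->
  exists mu : {measure set T2 -> \bar R},
    mu = pushforward m f :> (set T2 -> \bar R).
Proof.
move=> mf.
by exists
  (measure_function_pushforward__canonical__measure_function_Measure m mf).
Qed.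

Let product_sigma_finite d1 d2 (T1 : measurableType d1)
    (T2 : measurableType d2) (m1 : {sigma_finite_measure set T1 -> \bar R})
    (m2 : {sigma_finite_measure set T2 -> \bar R}) :
  sigma_finite setT (m1 \x m2).
Proof.
have /sigma_finiteP[F [TF ndF Foo]] := sigma_finiteT m1.
have /sigma_finiteP[G [TG ndG Goo]] := sigma_finiteT m2.
exists (fun n => F n `*` G n).
  rewrite -setXTT TF TG predeqE => -[x y]; split.
    move=> [/= [n _ Fnx] [k _ Gky]]; exists (maxn n k) => //; split.
    - by move: x Fnx; exact/subsetPset/ndF/leq_maxl.
    - by move: y Gky; exact/subsetPset/ndG/leq_maxr.
  by move=> [n _ []/= ? ?]; split; exists n.
move=> k; have [? ?] := Foo k; have [? ?] := Goo k.
split; first exact: measurableX.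
by rewrite product_measure1E// lte_mul_pinfty// ge0_fin_numE.
Qed.

Let pcons n (p : measurableTypeR R * n.-tuple R) : n.+1.-tuple R :=
  [the n.+1.-tuple R of p.1 :: p.2].

Let measurable_pcons n : measurable_fun [set: _] (@pcons n).
Proof. exact: measurable_cons. Qed.

Let lebesgueS_finite n (m : {sigma_finite_measure set (n.-tuple R) -> \bar R}) :
  sigma_finite [set: n.+1.-tuple R]
    (pushforward (@lebesgue_measure R \x m) (@pcons n)).
Proof.
have [F FT mF] : sigma_finite setT (@lebesgue_measure R \x m).
  exact: product_sigma_finite.
pose q (x : n.+1.-tuple R) : measurableTypeR R * n.-tuple R :=
  (thead x, [tuple of behead x]).
have mq : measurable_fun [set: _] q.
  apply/measurable_fun_pairP; split => /=.
    exact: measurable_tnth.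
  exact: measurable_behead.
have pq : cancel (@pcons n) q.
  by move=> [x t]; rewrite /q /pcons/= theadE; congr pair; exact: val_inj.
exists (fun k => q @^-1` F k).
  by apply/seteqP; split => // x _; have : [set: _] (q x) by []; rewrite FT.
move=> k; have [mFk Fk] := mF k; split.
  by rewrite -[X in measurable X]setTI; exact: mq.
rewrite /pushforward (_ : _ @^-1` _ = F k)//.
by rewrite -comp_preimage; apply/seteqP; split => p /=; rewrite pq.
Qed.

Let lebesgueP n :
  exists m : {sigma_finite_measure set (n.-tuple R) -> \bar R},
    m = lebesgue n :> (set _ -> \bar R).
Proof.
elim: n => [|n [m mE]].
  by exists (dirac ([tuple] : 0.-tuple R)).
have [l lE] := @pushforward_measureP _ _ _ _
  [the {measure set _ -> \bar R} of @lebesgue_measure R \x m] _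
  (@measurable_pcons n).
have lsf : sigma_finite setT l by rewrite lE; exact: lebesgueS_finite.
by exists (with_sigma_finite lsf); rewrite /= /with_sigma_finite lE /= -mE.
Qed.

Let lebesgue0 n : lebesgue n (@set0 (n.-tuple R)) = 0.
Proof. by have [m <-] := lebesgueP n; exact: measure0. Qed.

Let lebesgue_ge0 n (A : set (n.-tuple R)) : 0 <= lebesgue n A.
Proof. by have [m <-] := lebesgueP n; exact: measure_ge0. Qed.

Let lebesgue_sigma_additive n : semi_sigma_additive (@lebesgue R n).
Proof.
by have [m <-] := lebesgueP n; exact: measure_semi_sigma_additive.
Qed.

HB.instance Definition _ n := isMeasure.Build _ _ _ (@lebesgue R n)
  (lebesgue0 n) (@lebesgue_ge0 n) (@lebesgue_sigma_additive n).

Let lebesgue_sigma_finite n : sigma_finite [set: n.-tuple R] (lebesgue n).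
Proof. by have [m <-] := lebesgueP n; exact: sigma_finiteT. Qed.

HB.instance Definition _ n := Measure_isSigmaFinite.Build _ _ _
  (@lebesgue R n) (@lebesgue_sigma_finite n).

Lemma measurable_cube n (I : set R) : measurable I ->
  measurable [set x : n.-tuple R | forall i, I (tnth x i)].
Proof.
move=> mI.
rewrite (_ : [set x | _] = \bigcap_(i in [set: 'I_n])
  ((fun x => tnth x i) @^-1` I)); last first.
  by apply/seteqP; split => x /= h i; [move=> _|]; exact: h.
apply: fin_bigcap_measurable => // i _.
by rewrite -[X in measurable X]setTI; exact: measurable_tnth.
Qed.

Lemma lebesgue_cube n (I : set R) : measurable I ->
  lebesgue n [set x : n.-tuple R | forall i, I (tnth x i)] =
  lebesgue_measure I ^+ n.
Proof.
move=> mI; elim: n => [|n IHn].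
  rewrite expe0 /= diracE mem_set//; by case.
rewrite expeS -IHn /= /pushforward -product_measure1E//;
  last exact: measurable_cube.
congr (_ _); apply/seteqP; split => -[x t] /= h.
  split; first by have := h ord0; rewrite (tnth_nth 0%R).
  move=> i; have := h (lift ord0 i).
  by rewrite !(tnth_nth 0%R).
case: h => xI tI; move=> i; case: (unliftP ord0 i) => [j ->|->].
  by rewrite tnthS.
by [].
Qed.

End measure_structures.

Section sphere_measure.
Context {R : realType} (d : nat).
Local Notation point := (d.+1.-tuple R).
Local Open Scope ereal_scope.

(* Surface area on the sphere is d.+1 times the Lebesgue measure of the cone;
   the factor cancels in the normalization.  As a measure on the ambient space,
   [sigma] is concentrated on the sphere. *)
Definition sigma (A : set point) : \bar R :=
  lebesgue d.+1 (cone A) * ((fine (lebesgue d.+1 (cone sphere)))^-1)%:E.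

Let ball0 : set point := [set x | (0 < dot x x <= 1)%R].

Let proj (x : point) : point := scale (dot x x `^ (- 2^-1)) x.

Let powRE (r : R) : (0 < r)%R -> (r `^ (- 2^-1) = (Num.sqrt r)^-1)%R.
Proof. by move=> r0; rewrite powRN powR12_sqrt// ltW. Qed.

Let measurable_dot : measurable_fun [set: point] (fun x => dot x x).
Proof.
apply: measurable_sum => i.
by apply: measurable_funM; exact: measurable_tnth.
Qed.

Let measurable_ball0 : measurable ball0.
Proof.
have -> : ball0 = (fun x => dot x x) @^-1` [set` `]0%R, 1%R]].
  by apply/seteqP; split => x /=; rewrite in_itv.
by rewrite -[X in measurable X]setTI; apply: measurable_dot.
Qed.

Let measurable_proj : measurable_fun [set: point] proj.
Proof.
apply/measurable_fun_tnthP => i.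
rewrite (_ : _ \o _ = fun x : point => dot x x `^ (- 2^-1) * tnth x i)%R;
  last by apply/funext => x /=; rewrite tnth_mktuple.
apply: measurable_funM; last exact: measurable_tnth.
exact: (measurableT_comp (measurable_powR _) measurable_dot).
Qed.

Let dot_scale r (x : point) : (dot (scale r x) (scale r x) = r ^+ 2 * dot x x)%R.
Proof.
rewrite /dot mulr_sumr; apply: eq_bigr => i _.
by rewrite tnth_mktuple; ring.
Qed.

Let scaleA r s (x : point) : scale r (scale s x) = scale (r * s) x.
Proof. by apply: eq_from_tnth => i; rewrite !tnth_mktuple mulrA. Qed.

Let scale1 (x : point) : scale 1 x = x.
Proof. by apply: eq_from_tnth => i; rewrite !tnth_mktuple mul1r. Qed.

Let coneE (A : set point) : cone A = proj @^-1` A `&` ball0.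
Proof.
apply/seteqP; split=> [x /= [r + [y [Ay Sy] <-]]|x /= [Ax /andP[x0 x1]]].
  rewrite /= in_itv /= => /andP[r0 r1].
  have yy : dot y y = 1%R by [].
  have r20 : (0 < r ^+ 2)%R by rewrite exprn_gt0.
  rewrite /ball0 /proj /= dot_scale yy mulr1 powRE// sqrtr_sqr gtr0_norm//.
  by rewrite scaleA mulVf ?gt_eqF// scale1 r20 exprn_ile1// ltW.
have s0 : (0 < Num.sqrt (dot x x))%R by rewrite sqrtr_gt0.
exists (Num.sqrt (dot x x)).
  by rewrite /= in_itv /= s0 /= -sqrtr1 ler_sqrt.
exists (proj x); last by rewrite /proj powRE// scaleA mulfV ?gt_eqF// scale1.
split => //; rewrite /sphere /= /proj dot_scale powRE// exprVn sqr_sqrtr ?ltW//.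
by rewrite mulVf// gt_eqF.
Qed.

Let cone_sphere : cone sphere = ball0.
Proof.
apply/seteqP; split => x; first by rewrite coneE => -[].
move=> Bx.
have : cone [set: point] x by rewrite coneE.
by move=> [r r01 [y [_ Sy] <-]]; exists r => //; exists y.
Qed.

Let c := fine (lebesgue d.+1 (cone (@sphere R d.+1))).

Let sigmaE : exists m : {measure set point -> \bar R},
  m = sigma :> (set point -> \bar R).
Proof.
have [m mE] := pushforward_measureP
  [the {measure set point -> \bar R} of
    mrestr (@lebesgue R d.+1) measurable_ball0] measurable_proj.
have c0 : (0 <= c^-1)%R by rewrite invr_ge0 fine_ge0.
exists [the {measure set point -> \bar R} of mscale (NngNum c0) m].
apply/funext => A; rewrite /sigma -/c coneE.
rewrite [RHS]muleC; congr (_ * _).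
by rewrite mE.
Qed.

Let sigma0 : sigma set0 = 0.
Proof. by have [m <-] := sigmaE; exact: measure0. Qed.

Let sigma_ge0 A : 0 <= sigma A.
Proof. by have [m <-] := sigmaE; exact: measure_ge0. Qed.

Let sigma_sigma_additive : semi_sigma_additive sigma.
Proof. by have [m <-] := sigmaE; exact: measure_semi_sigma_additive. Qed.

HB.instance Definition _ := isMeasure.Build _ _ _ sigma
  sigma0 sigma_ge0 sigma_sigma_additive.

Let lebesgue_ball0_gt0 : 0 < lebesgue d.+1 ball0.
Proof.
pose I := [set` `]0%R, (d.+1%:R^-1)%R]] : set R.
have mI : measurable I by exact: measurable_itv.
have d0 : (0 < d.+1%:R^-1 :> R)%R by rewrite invr_gt0 ltr0n.
apply: (@lt_le_trans _ _
  (lebesgue d.+1 [set x : point | forall i, I (tnth x i)])).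
  rewrite lebesgue_cube//; apply: expe_gt0.
  by rewrite /I lebesgue_measure_itv /= lte_fin d0 -EFinB subr0 lte_fin.
apply: le_measure; rewrite ?inE//; first exact: measurable_cube.
move=> x xI; rewrite /ball0 /=; apply/andP; split.
  rewrite /dot big_ord_recl ltr_pwDl//.
    have := xI ord0; rewrite /I /= in_itv /= => /andP[h _].
    exact: mulr_gt0.
  by apply: sumr_ge0 => i _; rewrite -expr2 sqr_ge0.
apply: (@le_trans _ _ (\sum_(i < d.+1) (d.+1%:R^-1 : R)))%R.
  apply: ler_sum => i _; have := xI i.
  rewrite /I /= in_itv /= => /andP[h0 h1].
  rewrite -[leRHS]mulr1; apply: ler_pM => //; try exact: ltW.
  by rewrite (le_trans h1)// invf_le1// ler1n.
by rewrite sumr_const card_ord -[leLHS]mulr_natl mulfV// pnatr_eq0.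
Qed.

Let lebesgue_ball0_ltoo : lebesgue d.+1 ball0 < +oo.
Proof.
pose I := [set` `[(-1)%R, 1%R]] : set R.
have mI : measurable I by exact: measurable_itv.
apply: (@le_lt_trans _ _
  (lebesgue d.+1 [set x : point | forall i, I (tnth x i)])).
  apply: le_measure; rewrite ?inE//; first exact: measurable_cube.
  move=> x /= /andP[_ x1] i; rewrite /I /= in_itv /= -ler_norml.
  rewrite -(@ler_pXn2r _ 2) ?nnegrE// expr1n real_normK ?num_real//.
  apply: le_trans x1; rewrite /dot (bigD1 i)//= -expr2 lerDl.
  by apply: sumr_ge0 => j _; rewrite -expr2 sqr_ge0.
have [r rE] : exists r : R, lebesgue_measure I = r%:E.
  rewrite /I lebesgue_measure_itv /=.
  by case: ifP => _; [exists (1 - -1)%R; rewrite EFinB|exists 0%R].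
by rewrite lebesgue_cube// rE -EFin_expe ltry.
Qed.

Let sigmaT : sigma setT = 1.
Proof.
rewrite /sigma (_ : cone setT = cone sphere); last first.
  by rewrite cone_sphere coneE preimage_setT setTI.
have h0 := lebesgue_ball0_gt0; have hoo := lebesgue_ball0_ltoo.
have hf : lebesgue d.+1 ball0 \is a fin_num by rewrite ge0_fin_numE// ltW.
rewrite cone_sphere -{1}(fineK hf) -EFinM divff//.
by rewrite gt_eqF// fine_gt0// h0.
Qed.

HB.instance Definition _ := Measure_isProbability.Build _ _ _ sigma sigmaT.

End sphere_measure.
Arguments sigma {R} d A.

Section jittered_sampling.
Context {R : realType} (d : nat).
Local Notation point := (d.+1.-tuple R).
Local Open Scope ereal_scope.

Definition pole : point := [the point of 1%R :: nseq d 0%R].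

(* The measure of a cap does not depend on its center, since [sigma] is
   rotation invariant; the center is fixed here to be [pole]. *)
Definition sigma_cap (phi : R) : R := fine (sigma d (cap pole phi)).

Definition area_regular_partition (N : nat) (A : 'I_N -> set point) : Prop :=
  [/\ forall i, measurable (A i),
      trivIset [set: 'I_N] A,
      \bigcup_i A i = sphere
    & forall i, sigma d (A i) = (N%:R^-1)%:E].

Definition sigma_cell (N : nat) (A : set point) (B : set point) : \bar R :=
  N%:R%:E * sigma d (B `&` A).

(* \int_(A 0) ... \int_(A N.-1) F (y_0, ..., y_N.-1) dm_N.-1 ... dm_0,
   the outermost integral being over A 0. *)
Fixpoint iterated_integral (N : nat) :
    ('I_N -> set point -> \bar R) -> ('I_N -> set point) ->
    (N.-tuple point -> \bar R) -> \bar R :=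
  if N is M.+1 then fun m A F =>
    \int[m ord0]_(y in A ord0)
      iterated_integral (m \o lift ord0) (A \o lift ord0)
        (fun ys => F [the M.+1.-tuple point of y :: ys])
  else fun _ _ F => F [tuple].

Definition number_variance (N : nat) (A : 'I_N -> set point) (phi : R) :
    \bar R :=
  \int[sigma d]_(x in sphere)
    iterated_integral (fun i => sigma_cell N (A i)) A
      (fun y => ((\sum_(i < N) \1_(cap x phi) (tnth y i)
                  - N%:R * sigma_cap phi) ^+ 2)%:E).

End jittered_sampling.
Arguments sigma_cap {R} d phi.

(* The Landau relations of the library are only available for functions with
   values in a normed module; these are their analogues in \bar R. *)
Section ereal_landau.
Context {R : realType} {T : Type}.
Local Open Scope ereal_scope.

Definition elittleo (F : set_system T) (f g : T -> \bar R) : Prop :=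
  forall eps : R, (0 < eps)%R ->
    \forall x \near F, `|f x| <= eps%:E * `|g x|.

Definition ebigO (F : set_system T) (f g : T -> \bar R) : Prop :=
  \forall k \near +oo%R, \forall x \near F, `|f x| <= (k : R)%:E * `|g x|.

End ereal_landau.

(* Main.v *)
Require Import Defs.
From mathcomp Require Import all_boot all_order all_algebra.
From mathcomp Require Import all_classical all_reals all_analysis.
From mathcomp Require Import measurable_realfun ring lra.

Import Order.TTheory GRing.Theory Num.Theory.
Import numFieldNormedType.Exports.

Local Open Scope classical_set_scope.
Local Open Scope ring_scope.

Set Implicit Arguments.
Unset Strict Implicit.
Unset Printing Implicit Defensive.

(* Since the points are independent and the expected number of them in a cap
   is exactly [N sigma(C(phi))], the variance for a fixed center [x] is
   [\sum_i p_i (1 - p_i)] with [p_i = N sigma(A_i `&` C(x, phi))].  Only the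
   cells straddling the boundary of the cap contribute; they lie in the band of
   points at chordal distance between [s - delta] and [s + delta] from [x], with
   [s = 2 sin (phi / 2)] and [delta] a bound on the diameters, so that
   [V <= N sigma(band)].  The cone over a band is contained in a sector between
   two round cones, whence [sigma(band) = O(delta (s + delta)^(d-1))], and the
   three regimes follow from [delta = O(N^(-1/d))] and [sigma(C(phi)) ~ s^d].
   Rotation invariance of [sigma] reduces every cap to the one at the pole: a
   rotation is a product of three shears, which preserve Lebesgue measure by
   Fubini and translation invariance. *)

(** * Lebesgue measure on tuples *)

Section lebesgue_tuple.
Context {R : realType}.
Local Open Scope ereal_scope.

Definition tcons n (x : R) (t : n.-tuple R) : n.+1.-tuple R :=
  [the n.+1.-tuple R of x :: t].

Lemma tcons_eta n (x : n.+1.-tuple R) :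
  tcons (thead x) [tuple of behead x] = x.
Proof. by rewrite /tcons [RHS]tuple_eta; apply: val_inj. Qed.

Lemma tnth_tcons0 n (x : R) (t : n.-tuple R) : tnth (tcons x t) ord0 = x.
Proof. by []. Qed.

Lemma tnth_tconsS n (x : R) (t : n.-tuple R) i :
  tnth (tcons x t) (lift ord0 i) = tnth t i.
Proof. exact: tnthS. Qed.

Lemma tnth_beheadS n (x : n.+1.-tuple R) i :
  tnth [tuple of behead x] i = tnth x (lift ord0 i).
Proof. by rewrite -[in RHS](tcons_eta x) tnth_tconsS. Qed.

Lemma measurable_pcons n :
  measurable_fun [set: measurableTypeR R * n.-tuple R]
    (fun p => tcons p.1 p.2).
Proof. exact: measurable_cons. Qed.

Lemma measurable_preim d1 d2 (T1 : measurableType d1) (T2 : measurableType d2)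
  (f : T1 -> T2) (B : set T2) : measurable_fun setT f -> measurable B ->
  measurable (f @^-1` B).
Proof. by move=> mf mB; rewrite -[X in measurable X]setTI; exact: mf. Qed.

Lemma xsection_pcons n (A : set (n.+1.-tuple R)) x :
  xsection ((fun p : measurableTypeR R * n.-tuple R => tcons p.1 p.2) @^-1` A) x
  = [set t | A (tcons x t)].
Proof. by apply/seteqP; split => t; rewrite /xsection /= inE. Qed.

Lemma ysection_pcons n (A : set (n.+1.-tuple R)) t :
  ysection ((fun p : measurableTypeR R * n.-tuple R => tcons p.1 p.2) @^-1` A) t
  = [set x | A (tcons x t)].
Proof. by apply/seteqP; split => x; rewrite /ysection /= inE. Qed.

Lemma measurable_slice n (A : set (n.+1.-tuple R)) x :
  measurable A -> measurable [set t | A (tcons x t)].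
Proof.
move=> mA; rewrite -xsection_pcons; apply: measurable_xsection.
exact: measurable_preim (@measurable_pcons n) mA.
Qed.

Lemma measurable_yslice n (A : set (n.+1.-tuple R)) (t : n.-tuple R) :
  measurable A -> measurable [set x : measurableTypeR R | A (tcons x t)].
Proof.
move=> mA; rewrite -ysection_pcons; apply: measurable_ysection.
exact: measurable_preim (@measurable_pcons n) mA.
Qed.

Lemma lebesgueS n (A : set (n.+1.-tuple R)) :
  lebesgue n.+1 A =
  \int[lebesgue_measure]_x lebesgue n [set t | A (tcons x t)].
Proof.
rewrite /= /pushforward /product_measure1; apply: eq_integral => x _ /=.
by rewrite xsection_pcons.
Qed.

Lemma measurable_fun_slice n (A : set (n.+1.-tuple R)) : measurable A ->
  measurable_fun [set: measurableTypeR R]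
    (fun x => lebesgue n [set t | A (tcons x t)]).
Proof.
move=> mA; under eq_fun do rewrite -xsection_pcons.
apply: measurable_fun_xsection.
exact: measurable_preim (@measurable_pcons n) mA.
Qed.

(** Tonelli: integrating in the other order gives a measure with the same values on rectangles, so
    uniqueness of the product measure identifies the two. *)
Lemma lebesgueS_swap n (A : set (n.+1.-tuple R)) : measurable A ->
  lebesgue n.+1 A =
  \int[lebesgue n]_t lebesgue_measure [set x | A (tcons x t)].
Proof.
move=> mA; rewrite /= /pushforward.
rewrite (@product_measure_unique _ _ _ _ _ lebesgue_measure (@lebesgue R n)
  (product_measure2 lebesgue_measure (@lebesgue R n))).
- rewrite /= /product_measure2; apply: eq_integral => t _ /=.
  by rewrite ysection_pcons.
- by move=> X Y mX mY; exact: product_measure2E.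
- exact: measurable_preim (@measurable_pcons n) mA.
Qed.

(** The pushforward of Lebesgue measure under [x |-> r * x + v], multiplied by [r], gives half-open
    intervals their length, so it is Lebesgue measure by uniqueness. *)
Lemma lebesgue_measure_affine (r v : R) (A : set (measurableTypeR R)) :
  (0 < r)%R -> measurable A ->
  lebesgue_measure [set x | A (r * x + v)%R] = r^-1%:E * lebesgue_measure A.
Proof.
move=> r0 mA.
have mf : measurable_fun [set: measurableTypeR R]
    (fun x : measurableTypeR R => (r * x + v)%R : measurableTypeR R).
  by apply: measurable_funD => //; exact: measurable_funM.
have [m mE] := pushforward_measureP (@lebesgue_measure R) mf.
have r0' : (0 <= r)%R by exact: ltW.
suff -> : lebesgue_measure A = mscale (NngNum r0') m A.
  by rewrite /mscale/= muleA -EFinM mulVf ?gt_eqF// mul1e mE.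
apply: lebesgue_measure_unique => //.
move=> X [[a b] _ <-] /=; rewrite /mscale /= mE /pushforward.
rewrite [X in lebesgue_measure X = _](_ : _ = `]a, b]%classic) //.
rewrite (_ : _ @^-1` _ = `](r^-1 * (a - v))%R, (r^-1 * (b - v))%R]%classic).
  rewrite lebesgue_measure_itv /= lte_fin lebesgue_measure_itv /= lte_fin
    ltr_pM2l ?invr_gt0// ltrD2r.
  case: ifPn => _; last by rewrite mule0.
  rewrite -!EFinB -EFinM -mulrBr mulrA mulfV ?gt_eqF// mul1r; congr EFin; ring.
apply/seteqP; split => x /=; rewrite !in_itv /= ltr_pdivrMl// ler_pdivlMl//.
  by rewrite ltrBlDr lerBrDr.
by rewrite ltrBlDr lerBrDr.
Qed.


Definition affine n (r : R) (v x : n.-tuple R) : n.-tuple R :=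
  [tuple (r * tnth x i + tnth v i)%R | i < n].

Lemma affine_tcons n r (v : n.+1.-tuple R) x (t : n.-tuple R) :
  affine r v (tcons x t) =
  tcons (r * x + thead v)%R (affine r [tuple of behead v] t).
Proof.
apply: eq_from_tnth => i; rewrite tnth_mktuple.
case: (unliftP ord0 i) => [j ->|->]; last by rewrite !tnth_tcons0.
by rewrite !tnth_tconsS tnth_mktuple tnth_beheadS.
Qed.

Lemma lebesgue_affine n (r : R) (v : n.-tuple R) (A : set (n.-tuple R)) :
  (0 < r)%R -> measurable A ->
  lebesgue n (affine r v @^-1` A) = (r^-1 ^+ n)%:E * lebesgue n A.
Proof.
move=> r0; elim: n v A => [|n IHn] v A mA.
  rewrite expr0 mul1e; congr (lebesgue 0 _); apply/seteqP.
  by split => x /=; rewrite (tuple0 (affine _ _ _)) (tuple0 x).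
have mf : measurable_fun [set: measurableTypeR R]
    (fun x : measurableTypeR R => (r * x + thead v)%R : measurableTypeR R).
  by apply: measurable_funD => //; exact: measurable_funM.
pose h (x : measurableTypeR R) := lebesgue n [set t | A (tcons x t)].
have mh : measurable_fun setT h by exact: measurable_fun_slice.
have h0 x : 0 <= h x by exact: measure_ge0.
rewrite !lebesgueS.
transitivity (\int[lebesgue_measure]_x
    ((r^-1 ^+ n)%:E * h (r * x + thead v)%R)).
  apply: eq_integral => x _.
  rewrite -(IHn [tuple of behead v]); last exact: measurable_slice.
  by congr (lebesgue n _); apply/seteqP; split => t /=; rewrite affine_tcons.
have ri : (0 <= r^-1)%R by rewrite invr_ge0 ltW.
rewrite ge0_integralZl//; last 2 first.
- exact: measurableT_comp mh mf.
- by rewrite lee_fin exprn_ge0.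
(* Change of variables in the head coordinate: the pushforward of Lebesgue measure is [r^-1] times
   Lebesgue measure, which supplies the remaining factor of [r^-1 ^+ n.+1]. *)
have [m mE] := pushforward_measureP (@lebesgue_measure R) mf.
have := @ge0_integral_pushforward _ _ _ _ _ _ mf (@lebesgue_measure R) setT h
  measurableT mh (fun y _ => h0 y).
rewrite preimage_setT /= => <-.
rewrite (_ : integral _ _ _ = \int[mscale (NngNum ri) lebesgue_measure]_y h y);
  last first.
  rewrite -mE; apply: eq_measure_integral => X mX _.
  by rewrite mE; exact: lebesgue_measure_affine.
rewrite ge0_integral_mscale//= muleA -EFinM; congr (_ * _).
by rewrite exprS mulrC.
Qed.

Definition head_shear n (f : n.-tuple R -> R) (x : n.+1.-tuple R) :=
  tcons (thead x + f [tuple of behead x])%R [tuple of behead x].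

Definition tail_shear n (w : n.-tuple R) (x : n.+1.-tuple R) :=
  tcons (thead x) (affine 1 (scale (thead x) w) [tuple of behead x]).

Lemma head_shear_tcons n (f : n.-tuple R -> R) x t :
  head_shear f (tcons x t) = tcons (x + f t)%R t.
Proof.
rewrite /head_shear (_ : [tuple of behead (tcons x t)] = t)//.
exact: val_inj.
Qed.

Lemma tail_shear_tcons n (w : n.-tuple R) x t :
  tail_shear w (tcons x t) = tcons x (affine 1 (scale x w) t).
Proof.
rewrite /tail_shear (_ : [tuple of behead (tcons x t)] = t)//.
exact: val_inj.
Qed.

Lemma measurable_head_shear n (f : n.-tuple R -> R) :
  measurable_fun setT f -> measurable_fun setT (head_shear f).
Proof.
move=> mf; apply: measurable_cons; last exact: measurable_behead.
apply: measurable_funD; first exact: measurable_tnth.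
exact: measurableT_comp mf (@measurable_behead _ _ _).
Qed.

Lemma measurable_tail_shear n (w : n.-tuple R) :
  measurable_fun setT (tail_shear w).
Proof.
apply: measurable_cons; first exact: measurable_tnth.
apply/measurable_fun_tnthP => i.
rewrite (_ : _ \o _ = fun x : n.+1.-tuple R =>
  (tnth x (lift ord0 i) + thead x * tnth w i)%R).
  apply: measurable_funD; first exact: measurable_tnth.
  by apply: measurable_funM => //; exact: measurable_tnth.
by apply/funext => x /=; rewrite !tnth_mktuple tnth_beheadS mul1r.
Qed.

(** For a fixed tail [t] the shear translates the line of heads by [f t], so slicing by tails
    reduces the claim to translation invariance on the line. *)
Lemma lebesgue_head_shear n (f : n.-tuple R -> R) A :
  measurable_fun setT f -> measurable A ->
  lebesgue n.+1 (head_shear f @^-1` A) = lebesgue n.+1 A.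
Proof.
move=> mf mA; rewrite !lebesgueS_swap//; last first.
  by apply: measurable_preim => //; exact: measurable_head_shear.
apply: eq_integral => t _.
have := lebesgue_measure_affine (f t) ltr01 (measurable_yslice t mA).
rewrite invr1 mul1e => <-; congr lebesgue_measure.
by apply/seteqP; split => x /=; rewrite head_shear_tcons mul1r.
Qed.

(** For a fixed head [x] the shear translates the tails by [scale x w], so slicing by heads
    suffices. *)
Lemma lebesgue_tail_shear n (w : n.-tuple R) A : measurable A ->
  lebesgue n.+1 (tail_shear w @^-1` A) = lebesgue n.+1 A.
Proof.
move=> mA; rewrite !lebesgueS; apply: eq_integral => x _.
rewrite (_ : [set t | _] = affine 1 (scale x w) @^-1` [set t | A (tcons x t)]).
  by rewrite lebesgue_affine ?invr1 ?expr1n ?mul1e//; exact: measurable_slice.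
by apply/seteqP; split => t /=; rewrite tail_shear_tcons.
Qed.

End lebesgue_tuple.

(** * Inner products, and rotations as products of shears *)

Section euclidean_tuple.
Context {R : realType}.

Lemma dotC n (x y : n.-tuple R) : dot x y = dot y x.
Proof. by apply: eq_bigr => i _; rewrite mulrC. Qed.

Lemma dot_ge0 n (x : n.-tuple R) : 0 <= dot x x.
Proof. by apply: sumr_ge0 => i _; rewrite -expr2 sqr_ge0. Qed.

Lemma dot_scalel n r (x y : n.-tuple R) : dot (scale r x) y = r * dot x y.
Proof.
by rewrite /dot mulr_sumr; apply: eq_bigr => i _; rewrite tnth_mktuple mulrA.
Qed.

Lemma dot_scaler n r (x y : n.-tuple R) : dot x (scale r y) = r * dot x y.
Proof. by rewrite dotC dot_scalel dotC. Qed.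

Lemma dot_affiner n r (x v y : n.-tuple R) :
  dot x (affine r v y) = r * dot x y + dot x v.
Proof.
rewrite /dot mulr_sumr -big_split; apply: eq_bigr => i _.
by rewrite tnth_mktuple/=; ring.
Qed.

Lemma dot_affinel n r (x v y : n.-tuple R) :
  dot (affine r v y) x = r * dot y x + dot v x.
Proof. by rewrite dotC dot_affiner (dotC x) (dotC x). Qed.

Lemma dot_tcons n (a b : R) (x y : n.-tuple R) :
  dot (tcons a x) (tcons b y) = a * b + dot x y.
Proof.
rewrite /dot big_ord_recl !tnth_tcons0; congr (_ + _).
by apply: eq_bigr => i _; rewrite !tnth_tconsS.
Qed.

Lemma scaleA n r s (x : n.-tuple R) : scale r (scale s x) = scale (r * s) x.
Proof. by apply: eq_from_tnth => i; rewrite !tnth_mktuple mulrA. Qed.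

Lemma scale1 n (x : n.-tuple R) : scale 1 x = x.
Proof. by apply: eq_from_tnth => i; rewrite !tnth_mktuple mul1r. Qed.

Lemma scale_tcons n r a (x : n.-tuple R) :
  scale r (tcons a x) = tcons (r * a) (scale r x).
Proof.
apply: eq_from_tnth => i; rewrite tnth_mktuple.
case: (unliftP ord0 i) => [j ->|->]; last by rewrite !tnth_tcons0.
by rewrite !tnth_tconsS tnth_mktuple.
Qed.

Lemma measurable_dot n (x : n.-tuple R) :
  measurable_fun [set: n.-tuple R] (dot x).
Proof.
apply: measurable_sum => i.
by apply: measurable_funM => //; exact: measurable_tnth.
Qed.

Lemma measurable_dot_diag n : measurable_fun [set: n.-tuple R] (fun x => dot x x).
Proof.
apply: measurable_sum => i.
by apply: measurable_funM; exact: measurable_tnth.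
Qed.

(* The rotation taking the pole to [z] and fixing their orthogonal complement,
   as a product of three shears. *)
Definition rotation n (z : n.+1.-tuple R) : n.+1.-tuple R -> n.+1.-tuple R :=
  let w : n.-tuple R := [tuple of behead z] in
  let f t := - dot w t / (1 + thead z) in
  head_shear f \o tail_shear w \o head_shear f.

(** The matrix form of the rotation. The head of the third shear simplifies because
    [dot w w = (1 - a) * (1 + a)]; dividing by [1 + a] is what excludes [a = -1]. *)
Lemma rotation_tcons n a (w : n.-tuple R) b (t : n.-tuple R) :
  a ^+ 2 + dot w w = 1 -> a != -1 ->
  rotation (tcons a w) (tcons b t) =
  tcons (a * b - dot w t)
    (affine 1 (scale (b - dot w t / (1 + a)) w) t).
Proof.
move=> aw a1; rewrite /rotation.
rewrite (_ : [tuple of behead (tcons a w)] = w); last exact: val_inj.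
rewrite (_ : thead (tcons a w) = a)// [LHS]/=.
have a0 : 1 + a != 0 by rewrite addrC -(opprK 1) subr_eq0.
rewrite head_shear_tcons tail_shear_tcons head_shear_tcons.
congr (tcons _ (affine _ (scale _ _) _)); last by rewrite mulNr.
rewrite dot_affiner dot_scaler.
have -> : dot w w = (1 - a) * (1 + a) :> R.
  by rewrite (_ : dot w w = 1 - a ^+ 2); [ring|rewrite -aw; ring].
by field.
Qed.

End euclidean_tuple.

(** * Rotations *)

Section rotations.
Context {R : realType}.

(** These properties pass through the definition of [sigma]: isometry and homogeneity make the map
    commute with the radial projection, and Lebesgue measure of cones is preserved. *)
Definition rotation_like n (T : n.-tuple R -> n.-tuple R) : Prop :=
  [/\ measurable_fun setT T,
      forall x y, dot (T x) (T y) = dot x y,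
      forall r x, T (scale r x) = scale r (T x)
    & forall A, measurable A -> lebesgue n (T @^-1` A) = lebesgue n A].

Lemma rotation_like_comp n (T U : n.-tuple R -> n.-tuple R) :
  rotation_like T -> rotation_like U -> rotation_like (T \o U).
Proof.
move=> [mT dT sT lT] [mU dU sU lU]; split => [|x y|r x|A mA] /=.
- exact: measurableT_comp mT mU.
- by rewrite dT.
- by rewrite sU sT.
- by rewrite comp_preimage lU ?lT//; exact: measurable_preim mT mA.
Qed.

Lemma measurable_rotation_fun n (w : n.-tuple R) a :
  measurable_fun setT (fun t => - dot w t / a).
Proof.
apply: measurable_funM => //; apply: measurableT_comp => //.
exact: measurable_dot.
Qed.

Lemma rotation_likeP n (z : n.+1.-tuple R) : sphere z -> thead z != -1 ->
  rotation_like (rotation z).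
Proof.
have mh := measurable_head_shear
  (measurable_rotation_fun [tuple of behead z] (1 + thead z)).
have mt := measurable_tail_shear [tuple of behead z].
have mht := measurableT_comp mt mh.
move=> Sz z1; split => [|x y|r x|A mA].
- exact: measurableT_comp mh mht.
- move: Sz z1; rewrite /sphere /=; rewrite -(tcons_eta z) dot_tcons.
  move: (thead z) [tuple of behead z] => a w; rewrite -expr2 => aw a1.
  rewrite -(tcons_eta x) -(tcons_eta y).
  move: (thead x) [tuple of behead x] => b t.
  move: (thead y) [tuple of behead y] => c u.
  rewrite !rotation_tcons// !dot_tcons !dot_affiner !dot_affinel !dot_scaler.
  rewrite !dot_scalel (dotC t w).
  rewrite (_ : dot w w = (1 - a) * (1 + a)).
    have a0 : 1 + a != 0 by rewrite addrC -(opprK 1) subr_eq0.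
    by field.
  by rewrite (_ : dot w w = 1 - a ^+ 2); [ring|rewrite -aw; ring].
- move: Sz z1; rewrite /sphere /=; rewrite -(tcons_eta z) dot_tcons.
  move: (thead z) [tuple of behead z] => a w; rewrite -expr2 => aw a1.
  rewrite -(tcons_eta x).
  move: (thead x) [tuple of behead x] => b t.
  rewrite scale_tcons !rotation_tcons// scale_tcons dot_scaler.
  congr tcons; first by ring.
  by apply: eq_from_tnth => i; rewrite !tnth_mktuple; ring.
- rewrite /rotation !comp_preimage lebesgue_head_shear//; last 2 first.
  + exact: measurable_rotation_fun.
  + apply: measurable_preim mt _; exact: measurable_preim mh mA.
  rewrite lebesgue_tail_shear; last exact: measurable_preim mh mA.
  rewrite lebesgue_head_shear//.
  exact: measurable_rotation_fun.
Qed.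

Lemma pole_tcons n : pole n = tcons 1 [tuple of nseq n 0] :> n.+1.-tuple R.
Proof. exact: val_inj. Qed.

Lemma dot_zero n (w : n.-tuple R) : dot w [tuple of nseq n 0] = 0.
Proof. by apply: big1 => i _; rewrite tnth_nseq mulr0. Qed.

Lemma rotation_pole n (z : n.+1.-tuple R) : sphere z -> thead z != -1 ->
  rotation z (pole n) = z.
Proof.
rewrite /sphere /=; rewrite pole_tcons -(tcons_eta z) dot_tcons.
move: (thead z) [tuple of behead z] => a w; rewrite -expr2 => aw a1.
rewrite rotation_tcons// dot_zero mulr1 subr0 mul0r subr0 scale1.
congr tcons; apply: eq_from_tnth => i.
by rewrite tnth_mktuple tnth_nseq mulr0 add0r.
Qed.

Lemma exists_rotation d (x : d.+1.-tuple R) : (0 < d)%N -> sphere x ->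
  exists2 T, rotation_like T & T (pole d) = x.
Proof.
move=> d0 Sx; have [x1|x1] := eqVneq (thead x) (-1); last first.
  by exists (rotation x); [exact: rotation_likeP|exact: rotation_pole].
case: d d0 x Sx x1 => // d _ x Sx x1.
(* A point of the sphere with head [-1] is the antipode of the pole. It is reached by two quarter
   turns towards a unit vector [z] orthogonal to the pole, which exists because [d] is positive. *)
pose w : d.+1.-tuple R := pole d.
pose z : d.+2.-tuple R := tcons 0 w.
have ww : dot w w = 1 by rewrite /w pole_tcons dot_tcons dot_zero addr0 mulr1.
have Sz : sphere z by rewrite /sphere /= dot_tcons ww mulr0 add0r.
have z1 : thead z != -1 by rewrite eq_sym oppr_eq0 oner_eq0.
exists (rotation z \o rotation z).
  by apply: rotation_like_comp; exact: rotation_likeP.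
rewrite /= rotation_pole//.
rewrite /z rotation_tcons//; last by rewrite ww expr0n add0r.
rewrite ww.
move: Sx; rewrite /sphere /= -(tcons_eta x) dot_tcons x1 mulrNN mulr1.
move=> /(canRL (addKr _)); rewrite addNr => x0.
have xi i : tnth [tuple of behead x] i = 0.
  apply/eqP; rewrite -sqrf_eq0 expr2; apply/eqP.
  move/eqP : x0; rewrite /dot psumr_eq0.
    by move/allP => /(_ i (mem_index_enum _)) /= /eqP.
  by move=> j _; rewrite -expr2 sqr_ge0.
congr tcons; first by rewrite mul0r sub0r.
apply: eq_from_tnth => i; rewrite !tnth_mktuple xi addr0 divr1; ring.
Qed.

End rotations.

(** * Surface measure of caps and bands *)

Section sphere_measure.
Context {R : realType}.
Local Open Scope ereal_scope.

(** The cone consists of the points of the punctured unit ball whose radial projection lies in [A].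
    Writing the inverse norm as a real power exhibits the projection as a measurable map. *)
Lemma coneE n (A : set (n.-tuple R)) :
  cone A = [set x | (0 < dot x x <= 1)%R /\
                    A (scale (dot x x `^ (- 2^-1)) x)].
Proof.
have powRE (r : R) : (0 < r)%R -> (r `^ (- 2^-1) = (Num.sqrt r)^-1)%R.
  by move=> r0; rewrite powRN powR12_sqrt// ltW.
apply/seteqP; split => [x [r /= + [y [Ay Sy] <-]]|x /= [/andP[x0 x1] Ax]].
  rewrite in_itv /= => /andP[r0 r1]; have yy : dot y y = 1%R by [].
  have r20 : (0 < r ^+ 2)%R by rewrite exprn_gt0.
  have -> : dot (scale r y) (scale r y) = (r ^+ 2)%R.
    by rewrite dot_scalel dot_scaler yy mulr1.
  rewrite powRE// sqrtr_sqr gtr0_norm// scaleA mulVf ?gt_eqF// scale1.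
  by rewrite r20 exprn_ile1// ltW.
have s0 : (0 < Num.sqrt (dot x x))%R by rewrite sqrtr_gt0.
exists (Num.sqrt (dot x x)).
  by rewrite /= in_itv /= s0 /= -sqrtr1 ler_sqrt.
exists (scale (dot x x `^ (- 2^-1)) x).
  split => //; rewrite /sphere /= dot_scalel dot_scaler powRE// mulrA -expr2.
  by rewrite exprVn sqr_sqrtr ?ltW// mulVf// gt_eqF.
by rewrite powRE// scaleA mulfV ?gt_eqF// scale1.
Qed.

Lemma measurable_cone n (A : set (n.-tuple R)) :
  measurable A -> measurable (cone A).
Proof.
move=> mA; rewrite coneE; apply: measurableI.
  rewrite [X in measurable X](_ : _ =
      (fun x => dot x x) @^-1` [set` `]0%R, 1%R]]).
    by apply: measurable_preim => //; exact: measurable_dot_diag.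
  by apply/seteqP; split => x /=; rewrite in_itv.
apply: measurable_preim mA; apply/measurable_fun_tnthP => i.
rewrite (_ : _ \o _ = fun x => dot x x `^ (- 2^-1) * tnth x i)%R;
  last by apply/funext => x /=; rewrite tnth_mktuple.
apply: measurable_funM; last exact: measurable_tnth.
exact: measurableT_comp (measurable_powR _) (@measurable_dot_diag _ _).
Qed.

Lemma measurable_sphere n : measurable (@sphere R n).
Proof.
rewrite [X in measurable X](_ : _ = (fun x => dot x x) @^-1` [set 1%R])//.
by apply: measurable_preim; [exact: measurable_dot_diag|exact: measurable_set1].
Qed.

(** Since [T] commutes with the radial projection and keeps norms, the preimage of the cone over [A]
    is the cone over the preimage of [A]. *)
Lemma sigma_rotation d (T : d.+1.-tuple R -> d.+1.-tuple R) A :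
  rotation_like T -> measurable A -> sigma d (T @^-1` A) = sigma d A.
Proof.
move=> [mT dT sT lT] mA; rewrite /sigma; congr (_ * _).
rewrite -(lT (cone A)); last exact: measurable_cone.
congr (lebesgue _ _); rewrite !coneE; apply/seteqP.
by split => x /=; rewrite dT sT.
Qed.

(** On the sphere, inner product [1 - e^2 / 2] with [x] means chordal distance [e] from [x]; with
    endpoints of this form the band is the ring that holds the straddling cells. *)
Definition band n (x : n.-tuple R) (a b : R) : set (n.-tuple R) :=
  [set y | sphere y /\ (a < dot x y <= b)%R].

Lemma measurable_band n (x : n.-tuple R) a b : measurable (band x a b).
Proof.
apply: measurableI; first exact: measurable_sphere.
rewrite [X in measurable X](_ : _ = dot x @^-1` [set` `]a, b]]).
  by apply: measurable_preim => //; exact: measurable_dot.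
by apply/seteqP; split => y /=; rewrite in_itv.
Qed.

Lemma measurable_cap n (x : n.-tuple R) phi : measurable (cap x phi).
Proof.
apply: measurableI; first exact: measurable_sphere.
rewrite [X in measurable X](_ : _ = dot x @^-1` [set` `]cos phi, +oo[]).
  by apply: measurable_preim => //; exact: measurable_dot.
by apply/seteqP; split => y /=; rewrite in_itv /= andbT.
Qed.

Lemma sigma_capE d (x : d.+1.-tuple R) phi : (0 < d)%N -> sphere x ->
  sigma d (cap x phi) = (sigma_cap d phi)%:E.
Proof.
move=> d0 Sx; have [T rT Tp] := exists_rotation d0 Sx.
rewrite /sigma_cap fineK; last by apply: fin_num_measure; exact: measurable_cap.
rewrite -(sigma_rotation rT); last exact: measurable_cap.
case: rT => _ dT _ _; congr sigma; apply/seteqP.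
by split => y; rewrite /cap /sphere/= -Tp !dT.
Qed.

Lemma sigma_band_pole d (x : d.+1.-tuple R) a b : (0 < d)%N -> sphere x ->
  sigma d (band x a b) = sigma d (band (pole d) a b).
Proof.
move=> d0 Sx; have [T rT Tp] := exists_rotation d0 Sx.
rewrite -(sigma_rotation rT); last exact: measurable_band.
case: rT => _ dT _ _; congr sigma; apply/seteqP.
by split => y; rewrite /band /sphere/= -Tp !dT.
Qed.

(** A zero factor would give total mass zero, whereas [sigma] is a probability. *)
Lemma sigma_normalization_gt0 d :
  (0 < (fine (lebesgue d.+1 (cone (@sphere R d.+1))))^-1)%R.
Proof.
rewrite lt_neqAle invr_ge0 fine_ge0 ?andbT; last exact: measure_ge0.
apply/negP; rewrite eq_sym => /eqP c0.
have : sigma d [set: d.+1.-tuple R] = 1 by exact: probability_setT.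
by rewrite /sigma c0 mule0 => -[] /eqP; rewrite eq_sym oner_eq0.
Qed.

Definition oball n (r : R) : set (n.-tuple R) := [set t | (dot t t < r ^+ 2)%R].

Lemma measurable_oball n r : measurable (@oball n r).
Proof.
rewrite [X in measurable X](_ : _ =
    (fun x => dot x x) @^-1` [set` `]-oo, (r ^+ 2)%R[]).
  by apply: measurable_preim => //; exact: measurable_dot_diag.
by apply/seteqP; split => x /=; rewrite in_itv.
Qed.

Lemma lebesgue_oball_ltoo n : lebesgue n (@oball n 1) < +oo.
Proof.
pose I := [set` `[(-1)%R, 1%R]] : set R.
have mI : measurable I by exact: measurable_itv.
apply: (@le_lt_trans _ _
  (lebesgue n [set x : n.-tuple R | forall i, I (tnth x i)])).
  apply: le_measure; rewrite ?inE; first exact: measurable_oball.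
    exact: measurable_cube.
  move=> x; rewrite /oball /= expr1n => /ltW x1 i.
  rewrite /I /= in_itv /= -ler_norml.
  rewrite -(@ler_pXn2r _ 2) ?nnegrE// expr1n real_normK ?num_real//.
  apply: le_trans x1; rewrite /dot (bigD1 i)//= -expr2 lerDl.
  by apply: sumr_ge0 => j _; rewrite -expr2 sqr_ge0.
rewrite lebesgue_cube// /I lebesgue_measure_itv /= lte_fin gtrN//.
by rewrite -EFinB -EFin_expe ltry.
Qed.

Lemma lebesgue_oball n r : (0 < n)%N -> (0 <= r)%R ->
  lebesgue n (@oball n r) = (r ^+ n * fine (lebesgue n (@oball n 1)))%:E.
Proof.
move=> n0; rewrite le_eqVlt => /predU1P[<-|r0].
  rewrite expr0n gtn_eqF// mul0r (_ : oball _ = set0) ?measure0//.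
  apply/seteqP; split => t //; rewrite /oball /= expr0n/=.
  by rewrite ltNge dot_ge0.
rewrite EFinM fineK; last first.
  by rewrite ge0_fin_numE//; exact: lebesgue_oball_ltoo.
pose v : n.-tuple R := [tuple of nseq n 0%R].
have ri : (0 < r^-1)%R by rewrite invr_gt0.
(* The ball of radius [r] is the preimage of the unit ball under scaling by [r^-1], with zero
   translation. *)
rewrite -[X in (X ^+ n)%:E]invrK.
rewrite -(lebesgue_affine v ri (@measurable_oball n 1)).
have v0 t : dot t v = 0%R by exact: dot_zero.
congr (lebesgue n _); apply/seteqP; split => t;
  rewrite /oball /= dot_affiner v0 dot_affinel (dotC v) v0 !addr0 expr1n mulrA;
  by rewrite -expr2 exprVn mulrC ltr_pdivrMr ?mul1r// exprn_gt0.
Qed.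

End sphere_measure.

(** * Upper bounds for bands through sectors between two round cones *)

Section band_estimates.
Context {R : realType}.
Local Open Scope ereal_scope.

Lemma lebesgue_shell_le n (t1 t2 x : R) : (0 < n)%N -> (0 <= t1 <= t2)%R ->
  (0 < x <= 1)%R ->
  lebesgue n (@oball R n (t2 * x) `\` oball (t1 * x)) <=
  ((t2 ^+ n - t1 ^+ n) * fine (lebesgue n (@oball R n 1)))%:E.
Proof.
move=> n0 /andP[t10 t12] /andP[x0 x1]; have t20 := le_trans t10 t12.
have x00 := ltW x0.
have w0 : (0 <= fine (lebesgue n (@oball R n 1)))%R by rewrite fine_ge0.
have -> : lebesgue n (@oball R n (t2 * x) `\` oball (t1 * x)) =
    lebesgue n (oball (t2 * x)) -
    lebesgue n (oball (t2 * x) `&` oball (t1 * x)).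
  apply: measureD; [exact: measurable_oball..|].
  change (lebesgue n (@oball R n (t2 * x)) < +oo).
  by rewrite lebesgue_oball// ?ltry// mulr_ge0.
rewrite setIidr; last first.
  move=> t; rewrite /oball /= => /lt_le_trans; apply.
  by rewrite lerXn2r ?nnegrE ?mulr_ge0// ler_wpM2r.
rewrite (lebesgue_oball n0 (mulr_ge0 t20 x00)).
rewrite (lebesgue_oball n0 (mulr_ge0 t10 x00)) -EFinB lee_fin -mulrBl ler_wpM2r//.
rewrite !exprMn -mulrBl ler_piMr ?exprn_ile1// subr_ge0.
by rewrite lerXn2r ?nnegrE.
Qed.

(** The region at heights in []0, 1]] between the round cones about the first axis whose half-angles
    have tangents [t1] and [t2]. *)
Definition sector n (t1 t2 : R) : set (n.+1.-tuple R) :=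
  [set z | (0 < thead z <= 1)%R /\
    (oball (t2 * thead z) `\` oball (t1 * thead z)) [tuple of behead z]].

Lemma measurable_sector n (t1 t2 : R) : measurable (@sector n t1 t2).
Proof.
apply: measurableI.
  rewrite [X in measurable X](_ : _ =
    (fun z : n.+1.-tuple R => thead z) @^-1` `]0%R, 1%R]); last first.
    by apply/seteqP; split => x /=; rewrite in_itv.
  by apply: measurable_preim => //; exact: measurable_tnth.
have mf (t : R) : measurable_fun setT (fun z : n.+1.-tuple R =>
    (dot [tuple of behead z] [tuple of behead z] - (t * thead z) ^+ 2)%R).
  apply: measurable_funB.
    exact: measurableT_comp (@measurable_dot_diag _ _) (@measurable_behead _ _ _).
  apply: measurable_funX; apply: measurable_funM => //.
  exact: measurable_tnth.
have mo t : measurable [set z : n.+1.-tuple R |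
    oball (t * thead z) [tuple of behead z]].
  rewrite [X in measurable X](_ : _ = (fun z : n.+1.-tuple R =>
    (dot [tuple of behead z] [tuple of behead z] - (t * thead z) ^+ 2)%R)
    @^-1` `]-oo, 0%R[).
    exact: measurable_preim.
  by apply/seteqP; split => z; rewrite /oball /= in_itv /= subr_lt0.
exact: measurableD (mo t2) (mo t1).
Qed.

(** Every slice is a shell whose measure is at most that of the shell at height 1, and the heights
    fill an interval of length 1. *)
Lemma lebesgue_sector n (t1 t2 : R) : (0 < n)%N -> (0 <= t1 <= t2)%R ->
  lebesgue n.+1 (@sector n t1 t2) <=
  ((t2 ^+ n - t1 ^+ n) * fine (lebesgue n (@oball R n 1)))%:E.
Proof.
move=> n0 t12; set M := (X in X%:E).
have mI : measurable (`]0%R, 1%R] : set R) by exact: measurable_itv.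
have bh x (t : n.-tuple R) : [tuple of behead (tcons x t)] = t by exact: val_inj.
have M0 : (0 <= M)%R.
  case/andP : t12 => t10 t12.
  rewrite /M mulr_ge0 ?fine_ge0// subr_ge0 lerXn2r ?nnegrE//.
  exact: le_trans t10 t12.
have slice x : lebesgue n [set t | @sector n t1 t2 (tcons x t)] <=
    (M * \1_(`]0%R, 1%R] : set R) x)%:E.
  rewrite indicE; case: (boolP (0 < x <= 1)%R) => [x01|x01].
    rewrite mem_set/= ?in_itv//= mulr1.
    rewrite (_ : [set t | _] = oball (t2 * x) `\` oball (t1 * x)).
      exact: lebesgue_shell_le.
    apply/seteqP; split => t; rewrite /sector /= !bh.
      by case.
    by move=> h; split.
  rewrite memNset/= ?in_itv//=; last exact/negP.
  rewrite mulr0 (_ : [set t | _] = set0) ?measure0//.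
  by apply/seteqP; split => t //; rewrite /sector /= => -[]; rewrite (negPf x01).
rewrite lebesgueS.
have mS : measurable (@sector n t1 t2) by exact: measurable_sector.
apply: (@le_trans _ _ (\int[lebesgue_measure]_x
    (M * \1_(`]0%R, 1%R] : set R) x)%:E)).
  apply: ge0_le_integral => //.
  - exact: measurable_fun_slice.
  - by apply/measurable_EFinP; apply: measurable_funM.
under eq_integral do rewrite EFinM.
rewrite ge0_integralZl//; last first.
  by apply/measurable_EFinP.
rewrite integral_indic// setIT.
change (M%:E * lebesgue_measure (`]0%R, 1%R] : set R) <= M%:E).
by rewrite lebesgue_measure_itv /= lte_fin ltr01 -EFinB subr0 mule1.
Qed.

(** A unit vector with inner product [c > 0] with the pole makes an angle of tangent
    [sqrt (c^-2 - 1)] with the axis. This decreases in [c] and is unchanged by scaling, so the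
    bounds [a] and [b] become the outer and inner cones. *)
Lemma cone_band_sub d (a b : R) : (0 < a <= b)%R -> (b <= 1)%R ->
  cone (band (pole d) a b) `<=`
  @sector d (Num.sqrt (b ^- 2 - 1)) (Num.sqrt (a ^- 2 - 1)).
Proof.
move=> /andP[a0 ab] b1 _ [r /= r01 [y [[Sy ayb] _] <-]].
have b0 : (0 < b)%R by exact: lt_le_trans ab.
have tsq c : (0 < c <= 1)%R -> (Num.sqrt (c ^- 2 - 1) ^+ 2 = c ^- 2 - 1)%R.
  move=> /andP[c0 c1]; rewrite sqr_sqrtr// subr_ge0 -exprVn exprn_ege1//.
  by rewrite invf_ge1.
move: r01 Sy ayb; rewrite in_itv /= => /andP[r0 r1].
rewrite -(tcons_eta y) pole_tcons /sphere /= !dot_tcons.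
move: (thead y) [tuple of behead y] => y0 u.
rewrite dotC dot_zero addr0 mul1r scale_tcons => Sy /andP[ay yb].
have y00 : (0 < y0)%R by exact: lt_trans ay.
have y01 : (y0 <= 1)%R by exact: le_trans b1.
have bh x (t : d.-tuple R) : [tuple of behead (tcons x t)] = t by exact: val_inj.
have uu : (dot u u = 1 - y0 ^+ 2)%R by rewrite -Sy; ring.
rewrite /sector /= bh (_ : thead _ = r * y0)%R//.
split; first by rewrite mulr_gt0//= mulr_ile1// ltW.
have r20 : (0 < r ^+ 2)%R by exact: exprn_gt0.
have E c : (0 < c <= 1)%R -> ((Num.sqrt (c ^- 2 - 1) * (r * y0)) ^+ 2 =
    r ^+ 2 * (c ^- 2 * y0 ^+ 2 - y0 ^+ 2))%R.
  by move=> c01; rewrite exprMn tsq//; ring.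
have D : dot (scale r u) (scale r u) = (r ^+ 2 * (1 - y0 ^+ 2))%R.
  by rewrite dot_scalel dot_scaler uu mulrA -expr2.
rewrite /oball /= D !E; last 2 first.
- by rewrite b0.
- by rewrite a0 (le_trans ab).
split.
  rewrite ltr_pM2l// ltrD2r mulrC -(ltr_pM2r (x := a ^+ 2)) ?exprn_gt0//.
  rewrite mul1r mulfVK ?gt_eqF ?exprn_gt0//.
  by rewrite ltrXn2r// ?nnegrE ltW.
apply/negP; rewrite -leNgt ler_pM2l// lerD2r mulrC ler_pdivrMr ?exprn_gt0//.
by rewrite mul1r lerXn2r// ?nnegrE ltW.
Qed.

Lemma tangent_le (a b : R) : (0 < a <= b)%R ->
  (Num.sqrt (b ^- 2 - 1) <= Num.sqrt (a ^- 2 - 1))%R.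
Proof.
move=> /andP[a0 ab]; have b0 := lt_le_trans a0 ab.
rewrite ler_wsqrtr// lerD2r lef_pV2 ?posrE ?exprn_gt0//.
by rewrite lerXn2r// nnegrE ltW.
Qed.

Lemma sigma_band_pole_le d : (0 < d)%N ->
  exists2 K : R, (0 <= K)%R & forall a b : R, (0 < a <= b)%R -> (b <= 1)%R ->
  sigma d (band (pole d) a b) <=
  (K * (Num.sqrt (a ^- 2 - 1) ^+ d - Num.sqrt (b ^- 2 - 1) ^+ d))%:E.
Proof.
move=> d0; set c := ((fine (lebesgue d.+1 (cone (@sphere R d.+1))))^-1)%R.
have c0 : (0 < c)%R by exact: sigma_normalization_gt0.
exists (fine (lebesgue d (@oball R d 1)) * c)%R.
  by rewrite mulr_ge0 ?fine_ge0// ltW.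
move=> a b ab b1; have /andP[a0 leab] := ab.
have b0 : (0 < b)%R by exact: lt_le_trans leab.
rewrite /sigma -/c mulrAC [X in (X * c)%R]mulrC EFinM.
rewrite lee_wpmul2r//; first by rewrite lee_fin ltW.
apply: le_trans (lebesgue_sector d0 _).
  apply: le_measure; rewrite ?inE.
  - by apply: measurable_cone; exact: measurable_band.
  - exact: measurable_sector.
  - exact: cone_band_sub.
by rewrite sqrtr_ge0 tangent_le.
Qed.

(** In the factorization of the difference of powers, each of the [n] terms of the cofactor is at
    most [y ^+ n.-1]. *)
Lemma subrX_le n (x y : R) : (0 <= x <= y)%R ->
  (y ^+ n - x ^+ n <= n%:R * y ^+ n.-1 * (y - x))%R.
Proof.
move=> /andP[x0 xy]; have y0 := le_trans x0 xy.
rewrite subrXX mulrC ler_wpM2r ?subr_ge0//.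
rewrite -[X in (X%:R * _)%R](card_ord n) mulr_natl -sumr_const.
apply: ler_sum => i _.
have i_le : (i <= n.-1)%N
  by rewrite -ltnS prednK// (leq_ltn_trans _ (ltn_ord i)).
rewrite -[in leRHS](subnK i_le) exprD ler_wpM2l ?exprn_ge0//.
by rewrite lerXn2r ?nnegrE.
Qed.

(* [t c] is the tangent of the angle of cosine [c]. *)
Lemma tangent_gap (beta e1 e2 : R) : (0 < beta)%R -> (0 <= e1 <= e2)%R ->
  (0 < e2)%R -> (e2 ^+ 2 <= 2 * (1 - beta))%R ->
  let t c := Num.sqrt (c ^- 2 - 1) in
  let a := (1 - e2 ^+ 2 / 2)%R in let b := (1 - e1 ^+ 2 / 2)%R in
  [/\ (beta <= a <= b)%R, (b <= 1)%R, (t a <= e2 / beta)%R &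
      (t a - t b <= 4 / beta ^+ 3 * (e2 - e1))%R].
Proof.
move=> be0 /andP[e10 e12] e20 e2be t a b.
have ba : (beta <= a)%R by rewrite /a; lra.
have a0 : (0 < a)%R by exact: lt_le_trans ba.
have ab : (a <= b)%R.
  by rewrite /a /b lerD2l lerN2 ler_pM2r// lerXn2r// nnegrE ltW.
have b1 : (b <= 1)%R by rewrite /b gerBl divr_ge0 ?exprn_ge0.
have b0 : (0 < b)%R by exact: lt_le_trans ab.
have a1 : (a <= 1)%R by exact: le_trans b1.
have tsq c : (0 < c <= 1)%R -> (t c ^+ 2 = c ^- 2 - 1)%R.
  move=> /andP[c0 c1]; rewrite sqr_sqrtr// subr_ge0 -exprVn exprn_ege1//.
  by rewrite invf_ge1.
have ta : (t a ^+ 2 = a ^- 2 - 1)%R by rewrite tsq// a0.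
have tb : (t b ^+ 2 = b ^- 2 - 1)%R by rewrite tsq// b0.
have ta0 : (0 <= t a)%R by exact: sqrtr_ge0.
have tb0 : (0 <= t b)%R by exact: sqrtr_ge0.
pose u := (a^-1)%R; pose v := (b^-1)%R; pose w := (beta^-1)%R.
have w0 : (0 < w)%R by rewrite invr_gt0.
have uw : (u <= w)%R by rewrite lef_pV2.
have u1 : (1 <= u)%R by rewrite invf_ge1.
have v1 : (1 <= v)%R by rewrite invf_ge1.
have vu : (v <= u)%R by rewrite lef_pV2.
have au : (a * u = 1)%R by rewrite mulfV// gt_eqF.
have bv : (b * v = 1)%R by rewrite mulfV// gt_eqF.
rewrite -exprVn -/u in ta; rewrite -exprVn -/v in tb.
(* The square of the tangent is [u^2 * (1 - a^2)], where [u <= w] and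
   [1 - a^2 = e2^2 - e2^4 / 4 <= e2^2]. *)
have tae : (t a <= e2 * w)%R.
  rewrite -(@ler_pXn2r _ 2) ?nnegrE//; last by rewrite mulr_ge0 ?ltW.
  rewrite ta exprMn.
  have -> : (u ^+ 2 - 1 = u ^+ 2 * (1 - a ^+ 2))%R.
    by rewrite mulrBr mulr1 -exprMn mulrC au expr1n.
  rewrite mulrC ler_pM ?sqr_ge0//.
  - by rewrite subr_ge0 exprn_ile1// ltW.
  - by rewrite /a; have := sqr_ge0 (e2 ^+ 2); nra.
  - by rewrite lerXn2r ?nnegrE ?(le_trans _ u1)// ltW.
split => //; first by rewrite ba.
have tae2 : (e2 / 2 <= t a)%R.
  rewrite -(@ler_pXn2r _ 2) ?nnegrE//; last by rewrite divr_ge0 ?ltW.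
  rewrite ta.
  have : (a ^+ 2 * u ^+ 2 = 1)%R by rewrite -exprMn au expr1n.
  have u2 : (1 <= u ^+ 2)%R by rewrite exprn_ege1.
  have aa : (a ^+ 2 <= a)%R by rewrite expr2 ler_piMl// ltW.
  have ea : (e2 ^+ 2 = 2 * (1 - a))%R by rewrite /a; field.
  have : (0 <= 1 - a)%R by rewrite subr_ge0.
  rewrite expr_div_n ea; nra.
(* The difference of the tangents is controlled through that of their squares,
   [u^2 - v^2 = (b - a) * (u * v) * (u + v)]; the lower bound [e2 / 2 <= t a] then allows division
   by the sum of the tangents. *)
have key : ((t a - t b) * (t a + t b) <= w ^+ 3 * 2 * (b - a))%R.
  have -> : ((t a - t b) * (t a + t b) = (u - v) * (u + v))%R.
    by rewrite -!subr_sqr ta tb; ring.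
  have -> : (u - v = (b - a) * (u * v))%R.
    by rewrite mulrBl (mulrCA b) bv mulrA au; ring.
  have uv : (u * v <= w * w)%R.
    by apply: ler_pM; rewrite ?(le_trans ler01)//; exact: le_trans uw.
  have uv2 : (u + v <= 2 * w)%R by lra.
  rewrite -[leLHS]mulrA [leRHS]mulrC ler_wpM2l ?subr_ge0//.
  rewrite (_ : w ^+ 3 * 2 = w * w * (2 * w))%R; last by ring.
  by apply: ler_pM => //; nra.
have e21 : (b - a = (e2 - e1) * (e2 + e1) / 2)%R by rewrite /a /b; field.
have e2s : (e2 + e1 <= 2 * e2)%R by lra.
have -> : (4 / beta ^+ 3 = 4 * w ^+ 3)%R by rewrite exprVn.
have w3 : (0 < w ^+ 3)%R by exact: exprn_gt0.
have tab : (t b <= t a)%R by rewrite tangent_le// a0.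
rewrite -(ler_pM2r (x := e2 / 2))//; last by rewrite divr_gt0.
apply: (@le_trans _ _ ((t a - t b) * (t a + t b))%R).
  by rewrite ler_wpM2l ?subr_ge0// (le_trans tae2)// lerDl.
apply: le_trans key _; rewrite e21.
have -> : (4 * w ^+ 3 * (e2 - e1) * (e2 / 2) =
  w ^+ 3 * 2 * ((e2 - e1) * (2 * e2) / 2))%R by field.
rewrite ler_pM2l ?mulr_gt0// ler_pM2r// ler_wpM2l// subr_ge0//.
Qed.

(** While inner products stay above [beta], the tangents are at most [e2 / beta] and their gap is
    [O(e2 - e1)]; [subrX_le] turns this into a bound on the difference of [d]-th powers. *)
Lemma sigma_band_chord_le d (beta : R) : (0 < d)%N -> (0 < beta)%R ->
  exists2 K : R, (0 <= K)%R & forall e1 e2 : R, (0 <= e1 <= e2)%R ->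
  (0 < e2)%R -> (e2 ^+ 2 <= 2 * (1 - beta))%R ->
  sigma d (band (pole d) (1 - e2 ^+ 2 / 2) (1 - e1 ^+ 2 / 2)) <=
  (K * (e2 ^+ d.-1 * (e2 - e1)))%:E.
Proof.
move=> d0 be0; have [K K0 HK] := sigma_band_pole_le d0.
exists (K * (d%:R * (beta^-1 ^+ d.-1 * (4 / beta ^+ 3))))%R.
  by rewrite !mulr_ge0// ?exprn_ge0// ?invr_ge0 ?exprn_ge0 ?ltW.
move=> e1 e2 e12 e20 e2be.
have [/andP[ba ab] b1 ta tab] := tangent_gap be0 e12 e20 e2be.
apply: le_trans (HK _ _ _ b1) _.
  by rewrite ab andbT (lt_le_trans be0).
rewrite lee_fin -mulrA ler_wpM2l//.
have a0 := lt_le_trans be0 ba.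
have b0 := lt_le_trans a0 ab.
have := @tangent_le (1 - e2 ^+ 2 / 2) (1 - e1 ^+ 2 / 2).
rewrite a0 ab => /(_ isT); move: ta tab.
set p := Num.sqrt ((1 - e2 ^+ 2 / 2) ^- 2 - 1).
set q := Num.sqrt ((1 - e1 ^+ 2 / 2) ^- 2 - 1) => tp tpq qp.
have q0 : (0 <= q)%R by exact: sqrtr_ge0.
have p0 := le_trans q0 qp.
apply: le_trans (subrX_le _ _) _; first by rewrite q0.
rewrite -!mulrA ler_wpM2l//.
rewrite [leRHS](_ : _ = (e2 / beta) ^+ d.-1 * (4 / beta ^+ 3 * (e2 - e1)))%R;
  last by rewrite exprMn; ring.
apply: ler_pM => //; [exact: exprn_ge0|by rewrite subr_ge0|].
by rewrite lerXn2r// nnegrE divr_ge0 ?ltW.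
Qed.

End band_estimates.

(** * Lower bound for caps *)

Section cap_estimates.
Context {R : realType}.

Lemma sigma_cap_ge d : exists2 k : R, 0 < k &
  forall phi s : R, 0 < s <= 1 -> s ^+ 2 = 2 - 2 * cos phi ->
  k * s ^+ d <= sigma_cap d phi.
Proof.
set c := (fine (lebesgue d.+1 (cone (@sphere R d.+1))))^-1.
have c0 : 0 < c by exact: sigma_normalization_gt0.
have d8 : 0 < (8 * d.+1%:R : R)^-1 by rewrite invr_gt0 mulr_gt0.
exists (4^-1 * (8 * d.+1%:R)^-1 ^+ d * c).
  by rewrite !mulr_gt0// exprn_gt0.
move=> phi s /andP[s0 s1] sphi.
have bh x (t : d.-tuple R) : [tuple of behead (tcons x t)] = t by exact: val_inj.
(* With this side the tail of a point of the box has norm at most [s / 8], so at heights at least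
   [1/4] the tangent of its angle to the axis is at most [s / 2]. *)
pose m := (8 * d.+1%:R : R)^-1 * s.
have m0 : 0 < m by rewrite mulr_gt0.
have ms : m * (8 * d.+1%:R) = s by rewrite /m mulrAC mulVf ?mul1r// mulf_neq0.
pose I : set R := `[4^-1, 2^-1]%classic; pose J : set R := `[0, m]%classic.
pose G : set (d.+1.-tuple R) :=
  [set z | I (thead z) /\ forall i, J (tnth [tuple of behead z] i)].
have mI : measurable I by exact: measurable_itv.
have mJ : measurable J by exact: measurable_itv.
have lG : lebesgue d.+1 G = (4^-1 * m ^+ d)%:E.
  rewrite /= /pushforward (_ : _ @^-1` _ =
      I `*` [set t : d.-tuple R | forall i, J (tnth t i)]).
    transitivity (lebesgue_measure I * lebesgue d
        [set t : d.-tuple R | forall i, J (tnth t i)])%E.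
      by apply: product_measure1E => //; exact: measurable_cube.
    have -> : lebesgue d [set t : d.-tuple R | forall i, J (tnth t i)] =
        (m ^+ d)%:E.
      rewrite lebesgue_cube// /J lebesgue_measure_itv/= lte_fin m0.
      by rewrite -EFinB subr0 EFin_expe.
    rewrite (_ : lebesgue_measure I = (4^-1)%:E) ?EFinM//.
    rewrite /I lebesgue_measure_itv/= lte_fin ifT; last by lra.
    by rewrite -EFinB; congr EFin; lra.
  by apply/seteqP; split => -[x t]; rewrite /G /= bh.
have mG : measurable G.
  apply: measurableI.
    by apply: (measurable_preim (f := fun z : d.+1.-tuple R => thead z)) mI;
      exact: measurable_tnth.
  apply: (measurable_preim (f := fun z : d.+1.-tuple R => [tuple of behead z]))
    (measurable_cube mJ).
  exact: measurable_behead.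
suff GC : G `<=` cone (cap (pole d) phi).
  rewrite -lee_fin /sigma_cap fineK; last first.
    by apply: fin_num_measure; exact: measurable_cap.
  rewrite /sigma -/c.
  rewrite (_ : 4^-1 * _ * c * s ^+ d = 4^-1 * m ^+ d * c); last first.
    by rewrite /m exprMn; ring.
  rewrite EFinM -lG; apply: lee_wpmul2r; first by rewrite lee_fin ltW.
  apply: le_measure; rewrite ?inE//.
  by apply: measurable_cone; exact: measurable_cap.
move=> z []; rewrite coneE -(tcons_eta z).
move: (thead z) [tuple of behead z] => x t.
rewrite bh (_ : thead _ = x)// /I /= in_itv /= => /andP[x4 x2] Jt.
have x0 : 0 < x by lra.
have d1 : (d%:R : R) + 1 = d.+1%:R by rewrite -natr1.
have d0 : 0 <= d%:R :> R by [].
have tt : dot t t <= s ^+ 2 / 64.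
  apply: (@le_trans _ _ (d%:R * m ^+ 2)).
    rewrite -[X in (X%:R * _)](card_ord d) mulr_natl -sumr_const.
    apply: ler_sum => i _; have := Jt i; rewrite /J /= in_itv /= => /andP[t0 tm].
    by rewrite expr2 ler_pM.
  rewrite -ms -d1 (_ : _ / 64 = (d%:R + 1) ^+ 2 * m ^+ 2); last by field.
  by rewrite ler_wpM2r ?sqr_ge0//; nra.
have tt0 := dot_ge0 t.
have s2 : 0 < s ^+ 2 <= 1 by rewrite exprn_gt0// exprn_ile1// ltW.
have cosE : cos phi = 1 - s ^+ 2 / 2 by rewrite sphi; field.
have N0 : 0 < x * x + dot t t by nra.
rewrite dot_tcons; set N := x * x + dot t t in N0 *.
split; first by apply/andP; split => //; rewrite /N; nra.
have pE : N `^ (- 2^-1) = (Num.sqrt N)^-1 by rewrite powRN powR12_sqrt// ltW.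
have sN0 : 0 < Num.sqrt N by rewrite sqrtr_gt0.
split.
  rewrite /sphere /= dot_scalel dot_scaler dot_tcons -/N pE mulrA -expr2.
  by rewrite exprVn sqr_sqrtr ?mulVf ?gt_eqF// ltW.
rewrite dot_scaler pole_tcons dot_tcons dotC dot_zero addr0 mul1r pE.
rewrite mulrC ltr_pdivlMr// cosE.
have c0' : 0 <= 1 - s ^+ 2 / 2 by lra.
suff : ((1 - s ^+ 2 / 2) * Num.sqrt N) ^+ 2 < x ^+ 2.
  by rewrite ltr_pXn2r// nnegrE; [apply: mulr_ge0 => //|]; exact: ltW.
rewrite exprMn sqr_sqrtr; last exact: ltW.
rewrite /N; move: s2 tt tt0; set S := s ^+ 2; set q := dot t t.
move=> /andP[S0 S1] qS q0.
(* Uses [S <= 1]. In the end the loss [(3 / 4) * S * x^2], at least [3 * S / 64], outweighs the gain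
   [q <= S / 64]. *)
have sq : (1 - S / 2) ^+ 2 <= 1 - S * (3 / 4) by nra.
apply: (@le_lt_trans _ _ ((1 - S * (3 / 4)) * (x * x + q))).
  by apply: ler_wpM2r => //; nra.
have xx : 16^-1 <= x ^+ 2 by nra.
have Sx : S * 16^-1 <= S * x ^+ 2 by rewrite ler_wpM2l// ltW.
have Sq : 0 <= S * q by rewrite mulr_ge0// ltW.
rewrite [ltLHS](_ : _ =
    x ^+ 2 + q - (3 / 4) * (S * x ^+ 2) - (3 / 4) * (S * q));
  last by field.
lra.
Qed.

(** * Chordal distance, and cells meeting the boundary of a cap *)

Section euclidean_distance.
Context {n : nat}.
Implicit Types f g : 'I_n -> R.

Lemma sum_cauchy_schwarz f g :
  (\sum_i f i * g i) ^+ 2 <= (\sum_i f i ^+ 2) * (\sum_i g i ^+ 2).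
Proof.
set p := \sum_i f i ^+ 2; set q := \sum_i g i ^+ 2; set r := \sum_i f i * g i.
have q0 : 0 <= q by apply: sumr_ge0 => i _; exact: sqr_ge0.
have [q1|q1] := eqVneq q 0.
  rewrite (_ : r = 0) ?expr0n ?q1 ?mulr0//; apply: big1 => i _.
  have /eqP : g i ^+ 2 = 0.
    by apply: (psumr_eq0P _ q1) => // j _; exact: sqr_ge0.
  by rewrite sqrf_eq0 => /eqP ->; rewrite mulr0.
have qp : 0 < q by rewrite lt_neqAle eq_sym q1.
(* This sum equals [q * (q * p - r ^+ 2)], and [q] is positive here. *)
have : 0 <= \sum_i (q * f i - r * g i) ^+ 2.
  by apply: sumr_ge0 => i _; exact: sqr_ge0.
have E (u v : R) : \sum_i (u * f i - v * g i) ^+ 2 =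
    u ^+ 2 * (\sum_i f i ^+ 2) - 2 * u * v * (\sum_i f i * g i) +
    v ^+ 2 * (\sum_i g i ^+ 2).
  rewrite !mulr_sumr -sumrB -big_split; apply: eq_bigr => i _ /=; ring.
rewrite E -/p -/q -/r.
rewrite (_ : _ + _ = q * (q * p - r ^+ 2)); last by ring.
by rewrite pmulr_rge0// subr_ge0 mulrC.
Qed.

Lemma edist_triangle (x y z : n.-tuple R) :
  Defs.edist x z <= Defs.edist x y + Defs.edist y z.
Proof.
pose f i := tnth x i - tnth y i; pose g i := tnth y i - tnth z i.
have sq0 (h : 'I_n -> R) : 0 <= \sum_i h i ^+ 2.
  by apply: sumr_ge0 => i _; exact: sqr_ge0.
have cs : \sum_i f i * g i <= Defs.edist x y * Defs.edist y z.
  rewrite /Defs.edist -sqrtrM//; apply: (le_trans (ler_norm _)).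
  by rewrite -sqrtr_sqr ler_wsqrtr// sum_cauchy_schwarz.
have d0 (u v : n.-tuple R) : 0 <= Defs.edist u v by exact: sqrtr_ge0.
rewrite -(@ler_pXn2r _ 2) ?nnegrE ?addr_ge0// sqrrD !sqr_sqrtr//.
rewrite [leLHS](_ : _ = \sum_i f i ^+ 2 + (\sum_i f i * g i) *+ 2 +
    \sum_i g i ^+ 2).
  by rewrite lerD2r lerD2l ler_pMn2r.
rewrite -sumrMnl -!big_split; apply: eq_bigr => i _ /=.
by rewrite -sqrrD /f /g; congr (_ ^+ _); ring.
Qed.

Lemma edist_sphere (x y : n.-tuple R) : sphere x -> sphere y ->
  Defs.edist x y ^+ 2 = 2 - 2 * dot x y.
Proof.
rewrite /sphere /= => Sx Sy.
rewrite sqr_sqrtr; last by apply: sumr_ge0 => i _; exact: sqr_ge0.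
transitivity (dot x x - 2 * dot x y + dot y y); last by rewrite Sx Sy; ring.
rewrite /dot mulr_sumr -sumrB -big_split; apply: eq_bigr => i _ /=; ring.
Qed.

Lemma dot_sphere_le1 (x y : n.-tuple R) : sphere x -> sphere y -> dot x y <= 1.
Proof.
move=> Sx Sy; have := sqr_ge0 (Defs.edist x y).
by rewrite edist_sphere//; lra.
Qed.

(* [s] is the chord subtended by the angle [phi]. *)
Lemma straddling_cell (x : n.-tuple R) (A : set (n.-tuple R)) (phi s r : R) :
  sphere x -> A `<=` sphere ->
  (forall y z, A y -> A z -> Defs.edist y z <= r) ->
  0 <= s -> s ^+ 2 = 2 - 2 * cos phi ->
  [\/ A `<=` cap x phi, A `&` cap x phi = set0 |
     A `<=` band x (1 - (s + r) ^+ 2 / 2) (1 - Num.max 0 (s - r) ^+ 2 / 2)].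
Proof.
move=> Sx AS Ar s0 sphi.
have [|nsub] := pselect (A `<=` cap x phi); first by constructor 1.
have [|/eqP/set0P[y [Ay [Sy xy]]]] := pselect (A `&` cap x phi = set0).
  by constructor 2.
constructor 3 => w Aw.
have [z [Az nz]] : exists z, A z /\ ~ cap x phi z.
  by apply: contrapT => /forallNP h; apply: nsub => z Az; apply: contrapT => nz;
    apply: (h z).
have Sz := AS _ Az; have Sw := AS _ Aw.
have xz : dot x z <= cos phi by rewrite leNgt; apply/negP => h; exact: nz.
have d0 (u v : n.-tuple R) : 0 <= Defs.edist u v by exact: sqrtr_ge0.
(* The cell has a point [y] inside the cap, at distance less than [s] from [x], and a point [z]
   outside, at distance at least [s]. Every [w] of the cell is within [r] of both. *)
have ys : Defs.edist x y < s.
  rewrite -(@ltr_pXn2r _ 2) ?nnegrE// edist_sphere// sphi; lra.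
have zs : s <= Defs.edist x z.
  rewrite -(@ler_pXn2r _ 2) ?nnegrE// edist_sphere// sphi; lra.
have w1 : Defs.edist x w < s + r.
  apply: le_lt_trans (edist_triangle _ y _) _.
  by apply: ltr_leD => //; exact: Ar.
(* Truncation at 0 keeps squaring monotone when [r] exceeds [s]. *)
have w2 : Num.max 0 (s - r) <= Defs.edist x w.
  rewrite ge_max d0/= lerBlDr (le_trans zs)//.
  by apply: le_trans (edist_triangle _ w _) _; rewrite lerD2l; exact: Ar.
have dw : dot x w = 1 - Defs.edist x w ^+ 2 / 2 by rewrite edist_sphere//; field.
split => //; rewrite dw ltrD2l lerD2l ltrN2 lerN2 ltr_pM2r// ler_pM2r//.
apply/andP; split.
  by rewrite ltr_pXn2r// nnegrE// ltW// (le_lt_trans _ w1).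
by rewrite ler_pXn2r// nnegrE// le_max lexx.
Qed.

End euclidean_distance.

End cap_estimates.

(** * The variance of jittered sampling *)

Section nonmeasurable_integral.
Local Open Scope ereal_scope.

Import HBNNSimple.

(* No measurability is needed: the integral of a nonnegative function is a
   supremum over the simple functions below it. *)
Lemma le_integral_nonneg d (T : measurableType d) (R : realType)
    (mu : {measure set T -> \bar R}) (D : set T) (f g : T -> \bar R) :
  (forall x, D x -> 0 <= f x) -> (forall x, D x -> f x <= g x) ->
  \int[mu]_(x in D) f x <= \int[mu]_(x in D) g x.
Proof.
move=> f0 fg; have g0 x : D x -> 0 <= g x.
  by move=> Dx; exact: le_trans (f0 _ Dx) (fg _ Dx).
rewrite !ge0_integralE//; apply: ub_ereal_sup => _ [h /= hf <-].
apply: ereal_sup_ubound; exists h => //= x; apply: le_trans (hf x) _.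
by rewrite /patch; case: ifPn => // /[!inE]; exact: fg.
Qed.

End nonmeasurable_integral.

Section jittered_variance.
Context {R : realType}.

Lemma integral_two_valued d (T : measurableType d)
    (mu : {measure set T -> \bar R}) (A B : set T) (p u v : R) :
  measurable A -> measurable B -> mu A = 1%E -> mu (A `&` B) = p%:E ->
  0 <= u -> 0 <= v ->
  (\int[mu]_(y in A) (if y \in B then u else v)%:E = (u * p + v * (1 - p))%:E)%E.
Proof.
move=> mA mB A1 pE u0 v0.
have mC : measurable (~` B) by exact: measurableC.
transitivity (\int[mu]_(y in A) (u%:E * (\1_B y)%:E + v%:E * (\1_(~` B) y)%:E))%E.
  apply: eq_integral => y _; rewrite !indicE in_setC; case: (y \in B) => /=.
    by rewrite mule1 mule0 adde0.
  by rewrite mule1 mule0 add0e.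
have mi E : measurable E -> measurable_fun A (fun y => (\1_E y : R)%:E).
  by move=> mE; apply/measurable_EFinP.
rewrite ge0_integralD//=; last 4 first.
- by move=> y _; rewrite -EFinM lee_fin mulr_ge0.
- by apply: measurable_funeM; exact: mi.
- by move=> y _; rewrite -EFinM lee_fin mulr_ge0.
- by apply: measurable_funeM; exact: mi.
rewrite !ge0_integralZl//; [|exact: mi|exact: mi].
rewrite !integral_indic// EFinD !EFinM (setIC B) pE; congr (_ + _ * _)%E.
rewrite setIC -setDE.
have : (mu A = mu (A `\` B) + mu (A `&` B))%E by exact: measureDI.
rewrite A1 pE.
by case: (mu _) => // r [] ->; rewrite addrK.
Qed.

(** Squared bias plus variance for a sum of independent Bernoulli variables. The shift [a] is
    arbitrary so that the induction can absorb the indicator of the first point: [a] becomes [1 + a]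
    with probability [p ord0] and stays [a] otherwise. *)
Lemma iterated_integral_sqr d N (m : 'I_N -> set (d.+1.-tuple R) -> \bar R)
    (A : 'I_N -> set (d.+1.-tuple R)) (B : set (d.+1.-tuple R))
    (p : 'I_N -> R) (a : R) :
  (forall i, exists mu : {measure set (d.+1.-tuple R) -> \bar R},
    mu = m i :> (set _ -> \bar R)) ->
  (forall i, measurable (A i)) -> measurable B ->
  (forall i, m i (A i) = 1%E) -> (forall i, m i (A i `&` B) = (p i)%:E) ->
  (forall i, 0 <= p i <= 1) ->
  iterated_integral m A
    (fun y => ((\sum_(i < N) \1_B (tnth y i) + a) ^+ 2)%:E) =
  ((\sum_i p i + a) ^+ 2 + \sum_i p i * (1 - p i))%:E.
Proof.
elim: N m A p a => [|N IH] m A p a hm mA mB A1 pE p01.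
  by rewrite /= !big_ord0 addr0.
rewrite [LHS]/=; set P := \sum_i p (lift ord0 i).
set V := \sum_i p (lift ord0 i) * (1 - p (lift ord0 i)).
have V0 : 0 <= V.
  apply: sumr_ge0 => i _; have /andP[p0 p1] := p01 (lift ord0 i).
  by rewrite mulr_ge0// subr_ge0.
have [mu muE] := hm ord0; rewrite -muE.
transitivity (\int[mu]_(y in A ord0)
    (if y \in B then (P + (1 + a)) ^+ 2 + V else (P + a) ^+ 2 + V)%:E)%E.
  apply: eq_integral => y _.
  rewrite (_ : (fun ys => _) = (fun ys : N.-tuple (d.+1.-tuple R) =>
      ((\sum_(i < N) \1_B (tnth ys i) + (\1_B y + a)) ^+ 2)%:E)); last first.
    apply/funext => ys; rewrite big_ord_recl (_ : tnth _ ord0 = y)//.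
    under eq_bigr do rewrite tnthS.
    by congr ((_ ^+ 2)%:E); ring.
  rewrite (IH _ _ (p \o lift ord0))//=.
  by rewrite -/P -/V indicE; case: (y \in B); rewrite ?add0r.
rewrite (@integral_two_valued _ _ _ _ _ (p ord0)) ?muE//.
- rewrite !big_ord_recl -/P -/V; congr EFin; ring.
- by rewrite addr_ge0 ?sqr_ge0.
- by rewrite addr_ge0 ?sqr_ge0.
Qed.

Lemma sigma_cell_measure d N (A : set (d.+1.-tuple R)) : measurable A ->
  exists mu : {measure set (d.+1.-tuple R) -> \bar R},
    mu = sigma_cell N A :> (set _ -> \bar R).
Proof.
move=> mA; exists [the {measure set _ -> \bar R} of
  mscale (NngNum (ler0n R N)) (mrestr (@sigma R d) mA)].
by [].
Qed.

Lemma sigma_cellE d N (A B : set (d.+1.-tuple R)) : measurable A ->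
  measurable B -> sigma_cell N A B = (N%:R * fine (sigma d (B `&` A)))%:E.
Proof.
move=> mA mB; rewrite EFinM fineK//.
by apply: fin_num_measure; exact: measurableI.
Qed.

(** Additivity over the partition. Applied to a cap it gives the expected number of points; applied
    to a band it sums the contributions of the straddling cells. *)
Lemma sum_sigma_cell d N (A : 'I_N -> set (d.+1.-tuple R)) (E : set _) :
  area_regular_partition A -> measurable E -> E `<=` sphere ->
  \sum_i N%:R * fine (sigma d (E `&` A i)) = N%:R * fine (sigma d E).
Proof.
move=> [mA tA AS _] mE ES; rewrite -mulr_sumr; congr (_ * _).
have mEA i : measurable (E `&` A i) by exact: measurableI.
rewrite sum_fine; last by move=> i _; exact: fin_num_measure.
congr fine; transitivity (sigma d (\big[setU/set0]_(i < N) (E `&` A i))).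
  apply/esym/measure_semi_additive_ord => //.
    by apply: trivIset_setIl.
  exact: bigsetU_measurable.
congr sigma; rewrite -big_distrr/= -bigcup_seq.
rewrite -[RHS](setIidl ES) -AS; congr (_ `&` _).
by apply/seteqP; split => x [i _ Aix]; exists i => //=; rewrite mem_index_enum.
Qed.

Lemma number_variance_bound d N (A : 'I_N -> set (d.+1.-tuple R))
    (phi s r : R) :
  (0 < d)%N -> (0 < N)%N -> area_regular_partition A ->
  (forall i y z, A i y -> A i z -> Defs.edist y z <= r) ->
  0 <= s -> s ^+ 2 = 2 - 2 * cos phi ->
  (0 <= number_variance A phi)%E /\
  (number_variance A phi <= N%:R%:E *
    sigma d (band (pole d) (1 - (s + r) ^+ 2 / 2)%R
                           (1 - Num.max 0 (s - r) ^+ 2 / 2)%R))%E.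
Proof.
move=> d0 N0 pA Ar s0 sphi; have [mA tA AS A1] := pA.
set a := 1 - (s + r) ^+ 2 / 2; set b := 1 - Num.max 0 (s - r) ^+ 2 / 2.
have NR : N%:R != 0 :> R by rewrite pnatr_eq0 -lt0n.
have ASi i : A i `<=` sphere by rewrite -AS; exact: bigcup_sup.
have fA i : N%:R * fine (sigma d (A i)) = 1 by rewrite A1 /= mulfV.
have mcap x := measurable_cap x phi.
have mband x := measurable_band x a b.
pose p x i := N%:R * fine (sigma d (cap x phi `&` A i)).
have fsig_le (E F : set (d.+1.-tuple R)) : measurable E -> measurable F ->
    E `<=` F -> fine (sigma d E) <= fine (sigma d F).
  move=> mE mF EF; apply: fine_le; rewrite ?fin_num_measure//.
  by apply: le_measure; rewrite ?inE.
have p01 x i : 0 <= p x i <= 1.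
  rewrite mulr_ge0 ?fine_ge0//= -(fA i) ler_wpM2l// fsig_le//.
  exact: measurableI.
have valE x : sphere x ->
    iterated_integral (fun i => sigma_cell N (A i)) A
      (fun y => ((\sum_(i < N) \1_(cap x phi) (tnth y i)
                  - N%:R * sigma_cap d phi) ^+ 2)%:E) =
    (\sum_i p x i * (1 - p x i))%:E.
  (* The bias vanishes: the [p x i] sum to [N * sigma_cap d phi], whatever the center. *)
  move=> Sx; rewrite (iterated_integral_sqr (p := p x))//.
  - rewrite /p sum_sigma_cell//; last by move=> y [].
    by rewrite sigma_capE//= subrr expr0n add0r.
  - by move=> i; exact: sigma_cell_measure.
  - by move=> i; rewrite sigma_cellE// setIid fA.
  - move=> i; rewrite (sigma_cellE _ (mA i) (measurableI _ _ (mA i)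
      (mcap _ x))).
    by rewrite setIAC setIid setIC.
have val_le x : sphere x -> \sum_i p x i * (1 - p x i) <=
    N%:R * fine (sigma d (band (pole d) a b)).
  move=> Sx; rewrite -(sigma_band_pole a b d0 Sx).
  rewrite -(sum_sigma_cell pA)//; last by move=> y [].
  apply: ler_sum => i _; have /andP[p0 p1] := p01 x i.
  have RHS0 : 0 <= N%:R * fine (sigma d (band x a b `&` A i)).
    by rewrite mulr_ge0 ?fine_ge0.
  (* In the first two cases [p x i] is 1 or 0 and the term vanishes; in the third the term is at
     most 1, the normalized mass of a cell lying wholly in the band. *)
  have [Ac|Ac|Ab] := straddling_cell Sx (ASi i) (Ar i) s0 sphi.
  - by rewrite /p (setIidr Ac) fA subrr mulr0.
  - by rewrite {1}/p setIC Ac measure0 mulr0 mul0r.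
  - by rewrite (setIidr Ab) fA mulr_ile1 ?subr_ge0// gerBl.
rewrite /number_variance; split.
  apply: integral_ge0 => x Sx; rewrite valE// lee_fin sumr_ge0// => i _.
  by have /andP[p0 p1] := p01 x i; rewrite mulr_ge0// subr_ge0.
set M := (_ * _)%E.
apply: (@le_trans _ _ (\int[sigma d]_(x in sphere) (cst M x)))%E.
  apply: le_integral_nonneg => x Sx; rewrite valE//.
    rewrite lee_fin sumr_ge0// => i _.
    by have /andP[p0 p1] := p01 x i; rewrite mulr_ge0// subr_ge0.
  rewrite /M -[X in (_ * X)%E]fineK ?fin_num_measure//.
  by rewrite -EFinM lee_fin val_le.
rewrite integral_cst; last exact: measurable_sphere.
rewrite -[leRHS]mule1; apply: lee_wpmul2l; first by rewrite mule_ge0.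
apply: probability_le1; exact: measurable_sphere.
Qed.

End jittered_variance.

(** * The three regimes *)

Section asymptotics.
Context {R : realType}.

Lemma lerXn2r_inv n (x y : R) : (0 < n)%N -> 0 <= y -> x ^+ n <= y ^+ n ->
  x <= y.
Proof.
move=> n0 y0 xy; have [x0|x0] := leP 0 x; last exact: le_trans (ltW x0) y0.
by rewrite -(@ler_pXn2r _ n).
Qed.

(** Mean value theorem, the derivative [cos] being bounded by 1. *)
Lemma normr_sin_le (x : R) : 0 <= x -> `|sin x| <= x.
Proof.
move=> x0.
have [c _] := @MVT_segment R sin cos 0 x x0
  (fun y _ => is_derive_sin y) (continuous_subspaceT (@continuous_sin R)).
rewrite sin0 !subr0 => ->; rewrite normrM (ger0_norm x0).
by rewrite ler_piMl// cos_max.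
Qed.

(** A chord is no longer than its arc: the left side is [4 * sin (phi / 2) ^+ 2]. *)
Lemma chord_le (phi : R) : 0 <= phi -> 2 - 2 * cos phi <= phi ^+ 2.
Proof.
move=> phi0; have h : 0 <= phi / 2 by rewrite divr_ge0.
have -> : cos phi = 1 - 2 * sin (phi / 2) ^+ 2.
  rewrite [in LHS](_ : phi = (phi / 2) *+ 2); last by rewrite -mulr_natr divfK.
  by rewrite cos_mulr2n cos2sin2 -mulr_natr; ring.
have : `|sin (phi / 2)| ^+ 2 <= (phi / 2) ^+ 2.
  by rewrite lerXn2r ?nnegrE// normr_sin_le.
rewrite real_normK ?num_real// expr_div_n; lra.
Qed.

Lemma powR_scale (d N : nat) : (0 < d)%N -> (0 < N)%N ->
  (N%:R `^ (- d%:R^-1)) ^+ d = (N%:R : R)^-1.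
Proof.
move=> d0 N0; rewrite -powR_mulrn ?powR_ge0// -powRrM mulNr mulVf.
  by rewrite powR_inv1.
by rewrite pnatr_eq0 -lt0n.
Qed.

(** After taking [d]-th powers the inequality reads [C ^+ d / e ^+ d <= N]. *)
Lemma near_scale_le (d : nat) (C e : R) : (0 < d)%N -> 0 < C -> 0 < e ->
  \forall N \near \oo, C * N%:R `^ (- d%:R^-1) <= e.
Proof.
move=> d0 C0 e0.
near=> N.
have N0 : (0 < N)%N by near: N; exact: nbhs_infty_ge.
apply: (lerXn2r_inv d0 (ltW e0)).
rewrite exprMn powR_scale// ler_pdivrMr ?ltr0n// mulrC -ler_pdivrMr ?exprn_gt0//.
near: N; exact: nbhs_infty_ger.
Unshelve. all: by end_near. Qed.

(** * Variance of partitions with cells of diameter at most [C * N^(-1/d)] *)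

Section cells_of_small_diameter.
Variables (d : nat) (A : forall N : nat, 'I_N -> set (d.+1.-tuple R)) (C : R).
Hypotheses (d0 : (0 < d)%N) (C0 : 0 < C).
Hypothesis pA : forall N : nat, (0 < N)%N -> area_regular_partition (@A N).
Hypothesis A_diam : forall N : nat, (0 < N)%N -> forall i y z,
  @A N i y -> @A N i z -> Defs.edist y z <= C * N%:R `^ (- d%:R^-1).

Let delta N := C * N%:R `^ (- d%:R^-1).

Let delta_gt0 N : (0 < N)%N -> 0 < delta N.
Proof. by move=> N0; rewrite mulr_gt0// powR_gt0// ltr0n. Qed.

Lemma number_variance_ge0 N phi : (0 <= number_variance (@A N) phi)%E.
Proof.
(* The partition hypothesis starts at [N = 1]; for [N = 0] the integrand is a plain square. *)
case: N => [|N].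
  by apply: integral_ge0 => x _; rewrite /= lee_fin sqr_ge0.
have s0 : 0 <= 2 - 2 * cos phi by have := cos_le1 phi; lra.
by have [] := number_variance_bound d0 (ltn0Sn N) (pA (ltn0Sn N))
  (A_diam (ltn0Sn N)) (sqrtr_ge0 _) (sqr_sqrtr s0).
Qed.

(** The ring of straddling cells has chordal width at most [2 * delta N], whence the factor 2 in the
    constant. *)
Lemma number_variance_le (beta : R) : 0 < beta ->
  exists2 K : R, 0 <= K & forall (N : nat) (phi s : R), (0 < N)%N -> 0 <= s ->
  s ^+ 2 = 2 - 2 * cos phi -> (s + delta N) ^+ 2 <= 2 * (1 - beta) ->
  (number_variance (@A N) phi <=
    (N%:R * (K * ((s + delta N) ^+ d.-1 * delta N)))%:E)%E.
Proof.
move=> be0; have [K K0 HK] := sigma_band_chord_le d0 be0.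
exists (K * 2); first by rewrite mulr_ge0.
move=> N phi s N0 s0 sphi sbe; have D0 := delta_gt0 N0.
have D00 := ltW D0.
have [_ /le_trans] := number_variance_bound d0 N0 (pA N0) (A_diam N0) s0 sphi.
apply; rewrite -/(delta N) EFinM lee_wpmul2l//.
have e0 : 0 < s + delta N by rewrite ltr_wpDl.
apply: le_trans (HK _ _ _ e0 sbe) _.
  by rewrite le_max lexx/= ge_max ltW//= lerD2l; lra.
have e00 := ltW e0.
rewrite lee_fin -mulrA ler_wpM2l// mulrCA ler_wpM2l ?exprn_ge0//.
have : s - delta N <= Num.max 0 (s - delta N) by rewrite le_max lexx orbT.
lra.
Qed.

(** For [s > 0] the cap lies in the band with [e1 = 0] and [e2 = s]; for [s = 0] it is empty. *)
Lemma sigma_cap_le : exists2 K : R, 0 <= K & forall phi s : R, 0 <= s <= 1 ->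
  s ^+ 2 = 2 - 2 * cos phi -> sigma_cap d phi <= K * s ^+ d.
Proof.
have h : 0 < 2^-1 :> R by rewrite invr_gt0.
have [K K0 HK] := sigma_band_chord_le d0 h.
exists K => // phi s /andP[s0 s1] sphi.
have Sp : sphere (pole d : d.+1.-tuple R).
  by rewrite /sphere /= pole_tcons dot_tcons dot_zero addr0 mulr1.
have cosE : cos phi = 1 - s ^+ 2 / 2 by rewrite sphi; field.
rewrite -lee_fin -(sigma_capE phi d0 Sp).
move: s0; rewrite le_eqVlt => /predU1P[s0|s0].
  rewrite (_ : cap _ _ = set0) ?measure0 -?s0 ?lee_fin ?mulr_ge0 ?exprn_ge0//.
  apply/seteqP; split => // y [Sy]; rewrite cosE -s0 expr0n/= mul0r subr0.
  by rewrite ltNge dot_sphere_le1.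
apply: (@le_trans _ _ (sigma d (band (pole d) (1 - s ^+ 2 / 2)%R
    (1 - 0 ^+ 2 / 2)%R))).
  apply: le_measure; rewrite ?inE.
  - exact: measurable_cap.
  - exact: measurable_band.
  - move=> y [Sy]; rewrite cosE => h2; split => //; rewrite h2/=.
    by rewrite expr0n/= mul0r subr0 dot_sphere_le1.
apply: le_trans (HK 0 s _ s0 _) _.
- by rewrite lexx ltW.
- have : s ^+ 2 <= 1 by rewrite exprn_ile1// ltW.
  lra.
by rewrite subr0 lee_fin -exprSr prednK.
Qed.

(** For a fixed angle the bound on the variance is of order [N * delta N], and [delta N] tends to
    0. *)
Lemma large_caps (phi : R) : 0 < phi < pi / 2 ->
  elittleo \oo (fun N : nat => number_variance (@A N) phi)
    (fun N : nat => N%:R%:E).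
Proof.
move=> /andP[phi0 phi2] e e0.
have c0 : 0 < cos phi.
  by apply: cos_gt0_pihalf; rewrite phi2 andbT (lt_trans _ phi0)// oppr_lt0
    divr_gt0// pi_gt0.
have c1 := cos_le1 phi.
have s20 : 0 <= 2 - 2 * cos phi by lra.
pose s := Num.sqrt (2 - 2 * cos phi).
have s0 : 0 <= s by exact: sqrtr_ge0.
have sphi : s ^+ 2 = 2 - 2 * cos phi by rewrite sqr_sqrtr.
(* Since [s^2 = 2 - 2 * cos phi], this [beta] leaves a margin [cos phi] for the increase from [s] to
   [s + delta N], which [delta N <= cos phi / 8] respects. *)
have be0 : 0 < cos phi / 2 by rewrite divr_gt0.
have [K K0 HK] := number_variance_le be0.
have s2 : s <= 2.
  by apply: (@lerXn2r_inv 2) => //; rewrite sphi; lra.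
(* Adding 1 keeps the denominator positive when [K] is 0. *)
have eta0 : 0 < e / (K * 2 ^+ d.-1 + 1).
  by rewrite divr_gt0// ltr_wpDl// mulr_ge0.
have mu0 : 0 < cos phi / 8 by rewrite divr_gt0.
near=> N.
have N0 : (0 < N)%N by near: N; exact: nbhs_infty_ge.
have D1 : delta N <= cos phi / 8 by near: N; exact: near_scale_le.
have D2 : delta N <= e / (K * 2 ^+ d.-1 + 1) by near: N; exact: near_scale_le.
have D0 := delta_gt0 N0.
have D00 := ltW D0.
rewrite gee0_abs; last exact: number_variance_ge0.
rewrite gee0_abs ?lee_fin//.
have sD : (s + delta N) ^+ 2 <= 2 * (1 - cos phi / 2).
  by rewrite sqrrD sphi; nra.
apply: le_trans (HK N phi s N0 s0 sphi sD) _.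
rewrite -EFinM lee_fin mulrC ler_wpM2r//.
apply: (@le_trans _ _ ((K * 2 ^+ d.-1 + 1) * delta N)).
  rewrite mulrA ler_wpM2r//.
  apply: (@le_trans _ _ (K * 2 ^+ d.-1)); last by rewrite lerDl.
  rewrite ler_wpM2l// lerXn2r ?nnegrE ?addr_ge0//.
  by apply: (@lerXn2r_inv 2) => //; lra.
by rewrite mulrC -ler_pdivlMr// ltr_wpDl// mulr_ge0.
Unshelve. all: by end_near. Qed.

(** Once [delta N <= s N], the variance divided by [N * sigma_cap] is [O(delta N / s N)]. This ratio
    tends to 0, because its [d]-th power is [C^d / (N * s^d)] and [N * s^d] dominates a multiple of
    [N * sigma_cap]. *)
Lemma small_caps (phi : nat -> R) :
  phi N @[N --> \oo] --> 0 ->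
  N%:R * sigma_cap d (phi N) @[N --> \oo] --> +oo ->
  elittleo \oo (fun N : nat => number_variance (@A N) (phi N))
    (fun N : nat => (N%:R * sigma_cap d (phi N))%:E).
Proof.
move=> phi0 sigoo e e0.
pose s N := Num.sqrt (2 - 2 * cos (phi N)).
have s20 N : 0 <= 2 - 2 * cos (phi N) by have := cos_le1 (phi N); lra.
have s0 N : 0 <= s N by exact: sqrtr_ge0.
have sphi N : s N ^+ 2 = 2 - 2 * cos (phi N) by rewrite sqr_sqrtr.
(* By continuity the cosine is eventually at least [7 / 8], which makes [s N ^+ 2] at most
   [1 / 4]. *)
have s_small : \forall N \near \oo, s N <= 2^-1.
  have : cos (phi N) @[N --> \oo] --> cos (0 : R).
    by apply: (cvg_comp _ _ phi0); exact: continuous_cos.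
  rewrite cos0 => /cvgr_ge /(_ (7 / 8 : R)) h.
  have {h} : \forall N \near \oo, 7 / 8 <= cos (phi N) by apply: h; lra.
  apply: filterS => N cN.
  by apply: (@lerXn2r_inv 2); rewrite // sphi; lra.
have h2 : 0 < 2^-1 :> R by rewrite invr_gt0.
have [K K0 HK] := number_variance_le h2.
have [k k0 Hk] := @sigma_cap_ge R d.
have [K' K'0 HK'] := sigma_cap_le.
pose L := K * 2 ^+ d.-1 + 1.
have L0 : 0 < L by rewrite ltr_wpDl// mulr_ge0.
(* The bound 1 gives [s + delta <= 2 * s]; the other one gives [L * eta <= e * k] in the final
   comparison. *)
pose eta := Num.min 1 (e * k / L).
have eta0 : 0 < eta by rewrite lt_min ltr01 divr_gt0// mulr_gt0.
near=> N.
have N0 : (0 < N)%N by near: N; exact: nbhs_infty_ge.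
have sN : s N <= 2^-1 by near: N.
have D1 : delta N <= 2^-1 by near: N; exact: near_scale_le.
(* The threshold is chosen so that, through [sigma_cap <= K' * s^d], it yields
   [(C / eta)^d <= N * s^d], that is [delta N <= eta * s N]. *)
have big : (K' + 1) * (C / eta) ^+ d <= N%:R * sigma_cap d (phi N).
  by near: N; move/cvgryPge : sigoo; exact.
have D0 := delta_gt0 N0.
have D00 := ltW D0.
have NR : 0 < N%:R :> R by rewrite ltr0n.
have NR0 := ltW NR.
have eta00 := ltW eta0.
have s01 : s N <= 1 by lra.
have s01' : 0 <= s N <= 1 by rewrite s0.
have up := HK' _ _ s01' (sphi N).
have Ds : delta N <= eta * s N.
  apply: (lerXn2r_inv d0); first by rewrite mulr_ge0// ltW.
  rewrite /delta !exprMn powR_scale// ler_pdivrMr//.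
  rewrite (_ : _ * N%:R = N%:R * s N ^+ d * eta ^+ d); last by ring.
  rewrite -ler_pdivrMr ?exprn_gt0// -expr_div_n.
  have K'1 : 0 < K' + 1 by rewrite ltr_wpDl.
  rewrite -(ler_pM2l K'1) (le_trans big)// mulrCA ler_wpM2l//.
  by rewrite (le_trans up)// ler_wpM2r ?exprn_ge0// lerDl.
have sN0 : 0 < s N.
  by rewrite -(pmulr_rgt0 _ eta0) (lt_le_trans D0).
have lo : k * s N ^+ d <= sigma_cap d (phi N) by apply: Hk => //; rewrite sN0.
have sg0 : 0 <= sigma_cap d (phi N).
  by rewrite (le_trans _ lo)// mulr_ge0 ?exprn_ge0// ltW.
rewrite gee0_abs; last exact: number_variance_ge0.
rewrite gee0_abs ?lee_fin ?mulr_ge0//.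
have sD : (s N + delta N) ^+ 2 <= 2 * (1 - 2^-1).
  rewrite (_ : 2 * (1 - 2^-1) = 1); last by field.
  by rewrite exprn_ile1// ?addr_ge0//; lra.
apply: le_trans (HK N (phi N) (s N) N0 (s0 N) (sphi N) sD) _.
rewrite -EFinM lee_fin [leRHS]mulrCA ler_wpM2l//.
apply: (@le_trans _ _ (e * (k * s N ^+ d))); last by rewrite ler_wpM2l// ltW.
have eta1 : eta <= 1 by rewrite ge_min lexx.
have etaL : L * eta <= e * k.
  by rewrite mulrC -ler_pdivlMr// ge_min lexx orbT.
have D2 : s N + delta N <= 2 * s N by nra.
apply: (@le_trans _ _ (L * eta * s N ^+ d)); last first.
  by rewrite mulrA ler_wpM2r ?exprn_ge0.
rewrite -[in leRHS](prednK d0) exprSr.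
apply: (@le_trans _ _ (K * ((2 * s N) ^+ d.-1 * (eta * s N)))).
  rewrite ler_wpM2l// ler_pM ?exprn_ge0 ?addr_ge0//.
  apply: lerXn2r => //; rewrite nnegrE; first exact: addr_ge0.
  exact: mulr_ge0.
rewrite exprMn (_ : K * _ = (K * 2 ^+ d.-1) * (eta * (s N ^+ d.-1 * s N)));
  last by ring.
rewrite -[leRHS]mulrA ler_wpM2r ?mulr_ge0 ?exprn_ge0//.
by rewrite lerDl.
Unshelve. all: by end_near. Qed.

(** With [nu = N^(-1/d)], both [s <= t * nu] and [delta N = C * nu] scale like [nu], and
    [N * nu^d = 1]. The bound [K * ((t + C)^(d-1) * C)] no longer involves [N], and [t + C <= 2 * t]
    once [t >= C]. *)
Lemma threshold_order :
  ebigO +oo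
    (fun t : R => limn_esup
      (fun N : nat => number_variance (@A N) (t * N%:R `^ (- d%:R^-1))))
    (fun t : R => (t ^+ d.-1)%:E).
Proof.
have h2 : 0 < 2^-1 :> R by rewrite invr_gt0.
have [K K0 HK] := number_variance_le h2.
near=> k; near=> t.
have t0 : 0 < t by near: t; exact: nbhs_pinfty_gt.
have t00 := ltW t0.
have C00 := ltW C0.
have tC : C <= t by near: t; apply: nbhs_pinfty_ge; exact: num_real.
have kK : K * (2 ^+ d.-1 * C) <= k by near: k; apply: nbhs_pinfty_ge; exact: num_real.
rewrite gee0_abs; last first.
  apply: limf_esup_ge0 => [|N]; last exact: number_variance_ge0.
  exact: filter_not_empty.
rewrite gee0_abs ?lee_fin ?exprn_ge0//.
apply: (@le_trans _ _ (K * ((t + C) ^+ d.-1 * C))%:E); last first.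
  rewrite -EFinM lee_fin.
  apply: (@le_trans _ _ (K * (2 ^+ d.-1 * C) * t ^+ d.-1)); last first.
    by rewrite ler_wpM2r// exprn_ge0// ltW.
  rewrite -!mulrA ler_wpM2l// [leRHS]mulrCA mulrC ler_wpM2l//.
  rewrite -exprMn lerXn2r ?nnegrE ?addr_ge0 ?mulr_ge0//; lra.
rewrite /limn_esup limf_esupE.
have [M _ HM] : \forall N \near \oo, (number_variance (@A N)
    (t * N%:R `^ (- d%:R^-1)) <= (K * ((t + C) ^+ d.-1 * C))%:E)%E.
  near=> N.
  have N0 : (0 < N)%N by near: N; exact: nbhs_infty_ge.
  have tN : (t + C) * N%:R `^ (- d%:R^-1) <= 1.
    by near: N; apply: near_scale_le => //; rewrite addr_gt0.
  set nu := N%:R `^ (- d%:R^-1) in tN *.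
  have nu0 : 0 < nu by rewrite powR_gt0// ltr0n.
  have nu00 := ltW nu0.
  pose s := Num.sqrt (2 - 2 * cos (t * nu)).
  have s0 : 0 <= s by exact: sqrtr_ge0.
  have sphi : s ^+ 2 = 2 - 2 * cos (t * nu).
    by rewrite sqr_sqrtr//; have := cos_le1 (t * nu); lra.
  have st : s <= t * nu.
    have tnu0 : 0 <= t * nu by rewrite mulr_ge0// ltW.
    by apply: (@lerXn2r_inv 2) => //; rewrite sphi chord_le.
  have DE : delta N = C * nu by [].
  have sDle : s + delta N <= (t + C) * nu by rewrite DE mulrDl lerD2r.
  have sD0 : 0 <= s + delta N by rewrite addr_ge0// ltW// delta_gt0.
  have sD : (s + delta N) ^+ 2 <= 2 * (1 - 2^-1).
    rewrite (_ : 2 * (1 - 2^-1) = 1); last by field.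
    by rewrite exprn_ile1//; exact: le_trans tN.
  apply: le_trans (HK N (t * nu) s N0 s0 sphi sD) _.
  rewrite lee_fin.
  apply: (@le_trans _ _ (N%:R * (K * (((t + C) * nu) ^+ d.-1 * (C * nu))))).
    rewrite ler_wpM2l// ler_wpM2l// DE ler_wpM2r ?mulr_ge0//.
    by rewrite -DE lerXn2r ?nnegrE// mulr_ge0 ?addr_ge0.
  rewrite exprMn (_ : _ * _ = (N%:R * (nu ^+ d.-1 * nu)) *
    (K * ((t + C) ^+ d.-1 * C))); last by ring.
  rewrite -exprSr prednK// powR_scale// mulfV ?mul1r//.
  by rewrite pnatr_eq0 -lt0n.
(* The upper limit is an infimum of suprema over neighbourhoods of infinity, so the tail from [M] on
   suffices. *)
apply: (@le_trans _ _ (ereal_sup [set number_variance (@A N)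
    (t * N%:R `^ (- d%:R^-1)) | N in [set N | (M <= N)%N]])).
  apply: ereal_inf_lbound; exists [set N | (M <= N)%N] => //.
  by exists M.
by apply: ub_ereal_sup => _ [N /= MN <-]; exact: HM.
Unshelve. all: by end_near. Qed.

End cells_of_small_diameter.

End asymptotics.

Theorem theorem3 (R : realType) (d : nat) (d_ge1 : (1 <= d)%N)
    (A : forall N : nat, 'I_N -> set (d.+1.-tuple R))
    (A_regular : forall N : nat, (1 <= N)%N ->
      area_regular_partition (A N))
    (C : R)
    (A_diam : forall N : nat, (1 <= N)%N -> forall i : 'I_N,
      (diam (A N i) <= (C * N%:R `^ (- d%:R^-1))%:E)%E) :
  [/\ (forall phi : R, 0 < phi < pi / 2 ->
        elittleo \oo
          (fun N : nat => number_variance (A N) phi)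
          (fun N : nat => N%:R%:E)),
      (forall phi : nat -> R,
        (forall N : nat, (1 <= N)%N -> 0 <= phi N <= pi) ->
        phi N @[N --> \oo] --> 0 ->
        N%:R * sigma_cap d (phi N) @[N --> \oo] --> +oo ->
        elittleo \oo
          (fun N : nat => number_variance (A N) (phi N))
          (fun N : nat => (N%:R * sigma_cap d (phi N))%:E))
    & ebigO +oo
        (fun t : R => limn_esup
          (fun N : nat => number_variance (A N) (t * N%:R `^ (- d%:R^-1))))
        (fun t : R => (t ^+ d.-1)%:E)].
Proof.
(* Enlarging the diameter constant is harmless and makes it positive. *)
pose K := Num.max C 1.
have K0 : 0 < K by rewrite lt_max ltr01 orbT.
have cell_diam N : (0 < N)%N -> forall i y z, A N i y -> A N i z ->
    Defs.edist y z <= K * N%:R `^ (- d%:R^-1).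
  move=> N0 i y z Ay Az; rewrite -lee_fin.
  apply: (@le_trans _ _ (diam (A N i))).
    by apply: ereal_sup_ubound; exists (y, z).
  apply: le_trans (A_diam N N0 i) _.
  by rewrite lee_fin ler_wpM2r ?powR_ge0// le_max lexx.
split=> [phi|phi _|].
- exact: (large_caps d_ge1 K0 A_regular cell_diam).
- exact: (small_caps d_ge1 K0 A_regular cell_diam).
- exact: (threshold_order d_ge1 K0 A_regular cell_diam).
Qed.
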